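(* Suppose $K_p=\mathbb R^n_+$, so that $\min\{c^\top x:Ax=b,\ x\in K_p\}$ is a linear optimization problem, and suppose $c\in\mathcal L=\operatorname{Null}(A)$. Let $\bar\delta\in(0,+\infty]$ be the best suboptimal extreme point gap. Suppose there exist $x\in V_p\cap\operatorname{int}K_p$ and $s\in V_d\cap\operatorname{int}K_d$. Suppose rPDHG is run from $z^{0,0}=(x^{0,0},y^{0,0})=(0,0)$ using the $\beta$-restart condition with $\beta:=1/e$ and the step-sizes $\tau=\tau_0:=1/\kappa$, $\sigma=\sigma_0:=1/(\lambda_{\max}\lambda_{\min})$. Given $\varepsilon_{\mathrm{cons}},\varepsilon_{\mathrm{gap}}>0$, let $T$ be the total number of OnePDHG iterations that are run in order to obtain (the first) $n$ for which $w^{n,0}=(x^{n,0},s^{n,0})$ satisfies $\mathrm{E}_{\mathrm{cons}}(w^{n,0})\le\varepsilon_{\mathrm{cons}}$ and $\mathrm{E}_{\mathrm{gap}}(w^{n,0})\le\varepsilon_{\mathrm{gap}}$. Then $$T\le133\,\kappa\cdot\left(\inf_{0<\delta\le\bar\delta}\frac{D_\delta}{r_\delta}\right)\cdot\left[\ln\big(17\,\kappa\,\operatorname{Dist}(0,\mathcal W^\star)\big)+\ln\left(\frac{1}{\varepsilon_{\mathrm{cons}}}\vee\frac{2\sqrt2\,\operatorname{Dist}(0,\mathcal W^\star)}{\varepsilon_{\mathrm{gap}}}\right)\right].$$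
   Context: Problem. $K_p=\mathbb R^n_+$ and $K_d:=K_p^*=\mathbb R^n_+$; $A\in\mathbb R^{m\times n}$ ($A\ne0$, rows not assumed independent), $b\in\mathbb R^m$, $c\in\mathbb R^n$. $\|\cdot\|$ is the Euclidean norm, $\operatorname{Dist}$ is Euclidean distance to a set, $B(w,r)$ is the Euclidean ball, $a\vee b=\max\{a,b\}$. $\mathcal L:=\operatorname{Null}(A)$, $\mathcal L^\perp=\operatorname{Im}(A^\top)$, $q:=A^\top(AA^\top)^\dagger b$, $V_p:=\{x:Ax=b\}$, $V_d:=c+\operatorname{Im}(A^\top)$, $V:=V_p\times V_d$, $K:=K_p\times K_d$, $\mathcal F:=V\cap K$. For $w=(x,s)\in\mathbb R^{2n}$, and with $c\in\mathcal L$, $\operatorname{Gap}(w):=c^\top x+q^\top s$. $\mathcal W^\star:=\mathcal F\cap\{w:\operatorname{Gap}(w)=0\}$. $\lambda_{\max},\lambda_{\min}$ are the largest and smallest positive singular values of $A$, and $\kappa:=\lambda_{\max}/\lambda_{\min}$. Best suboptimal extreme point gap. Let $\mathsf E_{\mathcal F}$ be the set of extreme points of $\mathcal F$. $\bar\delta:=\min\{\operatorname{Gap}(w):w\in\mathsf E_{\mathcal F}\setminus\mathcal W^\star\}$ if $\mathsf E_{\mathcal F}\setminus\mathcal W^\star\neq\emptyset$, and $\bar\delta:=+\infty$ otherwise. (The infimum above is over finite $\delta$.) Level-set measures. For $\delta>0$: $\mathcal W_\delta:=\mathcal F\cap\{w:\operatorname{Gap}(w)\le\delta\}$; diameter $D_\delta:=\max_{u,v\in\mathcal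 W_\delta}\|u-v\|$; conic radius $r_\delta:=\max\{r\ge0: w\in\mathcal W_\delta,\ B(w,r)\subseteq K\}$ (maximum over $w$ and $r$). Errors. $\mathrm{E}_{\mathrm{cons}}(w):=\max\{\operatorname{Dist}(w,V),\operatorname{Dist}(w,K)\}$, $\mathrm{E}_{\mathrm{gap}}(w):=\max\{0,\operatorname{Gap}(w)\}$. Algorithm. $L(x,y):=c^\top x+b^\top y-x^\top A^\top y$. For $z=(x,y)$, OnePDHG$(z)=(x^+,y^+)$ with $x^+=P_{K_p}(x-\tau(c-A^\top y))$ (Euclidean projection), $y^+=y+\sigma(b-A(2x^+-x))$. With $M:=\begin{pmatrix}\frac1\tau I_n & A^\top \\ A & \frac1\sigma I_m\end{pmatrix}\succeq0$, $\|z\|_M:=\sqrt{z^\top Mz}$. The normalized duality gap of $z=(x,y)\in K_p\times\mathbb R^m$ is, for $r>0$, $\rho(r;z):=\frac1r\sup\{L(x,\hat y)-L(\hat x,y):\hat x\in K_p,\ \|(\hat x,\hat y)-z\|_M\le r\}$. rPDHG: for outer iterations $n=0,1,2,\dots$, set $z^{n,k+1}=\text{OnePDHG}(z^{n,k})$ and $\bar z^{n,k}=\frac1k\sum_{i=1}^kz^{n,i}$ for $k\ge1$; at the first $k\ge1$ for which $(n,k)$ satisfies the restart condition, set $z^{n+1,0}:=\bar z^{n,k}$ and pass to outer iteration $n+1$. The $\beta$-restart condition ($\beta\in(0,1)$) holds at $(n,k)$ if $n=0$ and $k=1$, or if $n\ge1$ and $\rho(\|\bar z^{n,k}-z^{n,0}\|_M;\bar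 z^{n,k})\le\beta\,\rho(\|z^{n,0}-z^{n-1,0}\|_M;z^{n,0})$. Write $z^{n,k}=(x^{n,k},y^{n,k})$, $s^{n,k}:=c-A^\top y^{n,k}$, $w^{n,k}:=(x^{n,k},s^{n,k})$.
   Formalization: The bound on T is replaced by the maximum of 0 and the stated right-hand side, since for large tolerances the starting point is already accepted (T=0) while the sum of logarithms is negative; whenever T≥1 the bound is the stated one. *)

(* Defs.v *)
From HB Require Import structures.
From mathcomp Require Export all_boot all_order all_algebra.
From mathcomp Require Export all_classical all_reals all_analysis.
Export numFieldNormedType.Exports.
Export Order.TTheory GRing.Theory Num.Theory.

Set Implicit Arguments.
Unset Strict Implicit.
Unset Printing Implicit Defensive.

Local Open Scope classical_set_scope.
Local Open Scope ring_scope.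

(** * Euclidean geometry

    The library norm on matrices is the sup norm, hence [enorm]. *)

Definition dot (R : realType) (d : nat) (u v : 'cV[R]_d) : R :=
  \sum_(i < d) u i 0 * v i 0.

Definition enorm (R : realType) (d : nat) (u : 'cV[R]_d) : R :=
  Num.sqrt (dot u u).

Definition dist (R : realType) (d : nat) (w : 'cV[R]_d) (S : set 'cV[R]_d) : R :=
  inf [set enorm (w - v) | v in S].

Definition eball (R : realType) (d : nat) (w : 'cV[R]_d) (r : R) :
    set 'cV[R]_d :=
  [set v | enorm (v - w) <= r].

Definition is_nearest (R : realType) (d : nat) (S : set 'cV[R]_d)
    (x p : 'cV[R]_d) : Prop :=
  S p /\ forall u, S u -> enorm (x - p) <= enorm (x - u).

(* [xget 0 P] is an element of [P], here the unique one when [S] is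
   nonempty, closed and convex *)
Definition proj (R : realType) (d : nat) (S : set 'cV[R]_d) (x : 'cV[R]_d) :
    'cV[R]_d :=
  xget 0 [set p | is_nearest S x p].

Definition extreme_points (R : realType) (d : nat) (S : set 'cV[R]_d) :
    set 'cV[R]_d :=
  [set w | S w /\ forall (u v : 'cV[R]_d) (t : R), S u -> S v -> 0 < t < 1 ->
                  w = t *: u + (1 - t) *: v -> u = v].

(** * Singular values and Moore-Penrose inverse *)

Definition pos_singular_values (R : realType) (m n : nat) (A : 'M[R]_(m, n)) :
    set R :=
  [set s | 0 < s /\ eigenvalue (A^T *m A) (s ^+ 2)].

(* the set is finite, and nonempty when A != 0, so that the bounds below are
   attained *)
Definition lambda_max (R : realType) (m n : nat) (A : 'M[R]_(m, n)) : R :=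
  sup (pos_singular_values A).

Definition lambda_min (R : realType) (m n : nat) (A : 'M[R]_(m, n)) : R :=
  inf (pos_singular_values A).

Definition kappa (R : realType) (m n : nat) (A : 'M[R]_(m, n)) : R :=
  lambda_max A / lambda_min A.

Definition is_mp_inverse (R : realType) (m n : nat) (A : 'M[R]_(m, n))
    (B : 'M[R]_(n, m)) : Prop :=
  [/\ A *m B *m A = A, B *m A *m B = B,
      (A *m B)^T = A *m B & (B *m A)^T = B *m A].

(* [pinvmx] is only a one-sided partial inverse, not the Moore-Penrose one *)
Definition mp_inverse (R : realType) (m n : nat) (A : 'M[R]_(m, n)) :
    'M[R]_(n, m) :=
  xget 0 [set B | is_mp_inverse A B].

(** * The linear optimization problem

    A point w = (x, s) of R^{2n} is [col_mx x s : 'cV_(n + n)]. *)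

Definition orthant (R : realType) (n : nat) : set 'cV[R]_n :=
  [set x | forall i, 0 <= x i 0].

Definition qvec (R : realType) (m n : nat) (A : 'M[R]_(m, n)) (b : 'cV[R]_m) :
    'cV[R]_n :=
  A^T *m (mp_inverse (A *m A^T) *m b).

Definition Vp (R : realType) (m n : nat) (A : 'M[R]_(m, n)) (b : 'cV[R]_m) :
    set 'cV[R]_n :=
  [set x | A *m x = b].

Definition Vd (R : realType) (m n : nat) (A : 'M[R]_(m, n)) (c : 'cV[R]_n) :
    set 'cV[R]_n :=
  [set c + A^T *m y | y in [set: 'cV[R]_m]].

Definition Vpd (R : realType) (m n : nat) (A : 'M[R]_(m, n)) (b : 'cV[R]_m)
    (c : 'cV[R]_n) : set 'cV[R]_(n + n) :=
  [set w | Vp A b (usubmx w) /\ Vd A c (dsubmx w)].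

Definition Kpd (R : realType) (n : nat) : set 'cV[R]_(n + n) :=
  [set w | orthant (usubmx w) /\ orthant (dsubmx w)].

Definition feasible (R : realType) (m n : nat) (A : 'M[R]_(m, n))
    (b : 'cV[R]_m) (c : 'cV[R]_n) : set 'cV[R]_(n + n) :=
  Vpd A b c `&` @Kpd R n.

Definition Gap (R : realType) (m n : nat) (A : 'M[R]_(m, n))
    (b : 'cV[R]_m) (c : 'cV[R]_n) (w : 'cV[R]_(n + n)) : R :=
  dot c (usubmx w) + dot (qvec A b) (dsubmx w).

Definition Wopt (R : realType) (m n : nat) (A : 'M[R]_(m, n))
    (b : 'cV[R]_m) (c : 'cV[R]_n) : set 'cV[R]_(n + n) :=
  feasible A b c `&` [set w | Gap A b c w = 0].

(* [ereal_inf set0 = +oo]; otherwise a minimum, [extreme_points] being finite *)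
Definition best_gap (R : realType) (m n : nat) (A : 'M[R]_(m, n))
    (b : 'cV[R]_m) (c : 'cV[R]_n) : \bar R :=
  ereal_inf [set (Gap A b c w)%:E
            | w in extreme_points (feasible A b c) `\` Wopt A b c].

Definition Wlevel (R : realType) (m n : nat) (A : 'M[R]_(m, n))
    (b : 'cV[R]_m) (c : 'cV[R]_n) (delta : R) : set 'cV[R]_(n + n) :=
  feasible A b c `&` [set w | Gap A b c w <= delta].

(* The level sets are nonempty and compact under strict feasibility, so that
   the two suprema below are maxima. *)
Definition diameter (R : realType) (m n : nat) (A : 'M[R]_(m, n))
    (b : 'cV[R]_m) (c : 'cV[R]_n) (delta : R) : R :=
  sup [set rho | exists u v, [/\ Wlevel A b c delta u, Wlevel A b c delta v
                              & rho = enorm (u - v)]].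

Definition conic_radius (R : realType) (m n : nat) (A : 'M[R]_(m, n))
    (b : 'cV[R]_m) (c : 'cV[R]_n) (delta : R) : R :=
  sup [set r | 0 <= r /\ exists w, Wlevel A b c delta w
                                   /\ eball w r `<=` @Kpd R n].

Definition best_ratio (R : realType) (m n : nat) (A : 'M[R]_(m, n))
    (b : 'cV[R]_m) (c : 'cV[R]_n) : R :=
  inf [set diameter A b c delta / conic_radius A b c delta
      | delta in [set delta : R | 0 < delta /\ (delta%:E <= best_gap A b c)%E]].

Definition Econs (R : realType) (m n : nat) (A : 'M[R]_(m, n))
    (b : 'cV[R]_m) (c : 'cV[R]_n) (w : 'cV[R]_(n + n)) : R :=
  Num.max (dist w (Vpd A b c)) (dist w (@Kpd R n)).

Definition Egap (R : realType) (m n : nat) (A : 'M[R]_(m, n))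
    (b : 'cV[R]_m) (c : 'cV[R]_n) (w : 'cV[R]_(n + n)) : R :=
  Num.max 0 (Gap A b c w).

(** * PDHG with restarts

    An iterate z = (x, y) is [col_mx x y : 'cV_(n + m)]. *)

Definition Lagr (R : realType) (m n : nat) (A : 'M[R]_(m, n))
    (b : 'cV[R]_m) (c : 'cV[R]_n) (x : 'cV[R]_n) (y : 'cV[R]_m) : R :=
  dot c x + dot b y - dot x (A^T *m y).

Definition OnePDHG (R : realType) (m n : nat) (A : 'M[R]_(m, n))
    (b : 'cV[R]_m) (c : 'cV[R]_n) (tau sigma : R) (z : 'cV[R]_(n + m)) :
    'cV[R]_(n + m) :=
  let x := usubmx z in
  let y := dsubmx z in
  let x1 := proj (@orthant R n) (x - tau *: (c - A^T *m y)) in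
  let y1 := y + sigma *: (b - A *m (2%:R *: x1 - x)) in
  col_mx x1 y1.

Definition Mmx (R : realType) (m n : nat) (A : 'M[R]_(m, n)) (tau sigma : R) :
    'M[R]_(n + m) :=
  block_mx (tau^-1)%:M A^T A (sigma^-1)%:M.

Definition Mnorm (R : realType) (m n : nat) (A : 'M[R]_(m, n)) (tau sigma : R)
    (z : 'cV[R]_(n + m)) : R :=
  Num.sqrt (dot z (Mmx A tau sigma *m z)).

(* Normalized duality gap, extended-real valued because M may be singular.
   At r = 0 (where 0^-1 = 0) the value is 0.  In [restart_at] below, r = 0
   only occurs at a saddle point of [Lagr], where the gap is 0 for every
   r > 0 as well. *)
Definition ndg (R : realType) (m n : nat) (A : 'M[R]_(m, n))
    (b : 'cV[R]_m) (c : 'cV[R]_n) (tau sigma : R) (r : R)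
    (z : 'cV[R]_(n + m)) : \bar R :=
  ((r^-1)%:E *
   ereal_sup [set (Lagr A b c (usubmx z) (dsubmx zh)
                   - Lagr A b c (usubmx zh) (dsubmx z))%:E
             | zh in [set zh : 'cV[R]_(n + m) |
                       orthant (usubmx zh)
                       /\ (Mnorm A tau sigma (zh - z) <= r)%R]])%E.

(* \bar z^{j,k} when z0 = z^{j,0} *)
Definition avg_iter (R : realType) (m n : nat) (A : 'M[R]_(m, n))
    (b : 'cV[R]_m) (c : 'cV[R]_n) (tau sigma : R) (z0 : 'cV[R]_(n + m))
    (k : nat) : 'cV[R]_(n + m) :=
  k%:R^-1 *: \sum_(1 <= i < k.+1) iter i (OnePDHG A b c tau sigma) z0.

(* beta-restart condition at (j, k); [z i] stands for z^{i,0} *)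
Definition restart_at (R : realType) (m n : nat) (A : 'M[R]_(m, n))
    (b : 'cV[R]_m) (c : 'cV[R]_n) (tau sigma beta : R)
    (z : nat -> 'cV[R]_(n + m)) (j k : nat) : Prop :=
  let zbar := avg_iter A b c tau sigma (z j) k in
  if j is i.+1 then
    (ndg A b c tau sigma (Mnorm A tau sigma (zbar - z j)) zbar
     <= beta%:E * ndg A b c tau sigma (Mnorm A tau sigma (z j - z i)) (z j))%E
  else k = 1%N.

Definition restart_length (R : realType) (m n : nat) (A : 'M[R]_(m, n))
    (b : 'cV[R]_m) (c : 'cV[R]_n) (tau sigma beta : R)
    (z : nat -> 'cV[R]_(n + m)) (j k : nat) : Prop :=
  [/\ (0 < k)%N, restart_at A b c tau sigma beta z j k
    & forall l, (0 < l < k)%N -> ~ restart_at A b c tau sigma beta z j l].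

(* the outer iterations 0, ..., N-1 of rPDHG from zinit terminate, with
   restart points z^{j,0} = z j and inner lengths k j *)
Definition rPDHG_run (R : realType) (m n : nat) (A : 'M[R]_(m, n))
    (b : 'cV[R]_m) (c : 'cV[R]_n) (tau sigma beta : R)
    (zinit : 'cV[R]_(n + m)) (N : nat) (z : nat -> 'cV[R]_(n + m))
    (k : nat -> nat) : Prop :=
  z 0%N = zinit /\
  forall j, (j < N)%N ->
    restart_length A b c tau sigma beta z j (k j)
    /\ z j.+1 = avg_iter A b c tau sigma (z j) (k j).

Definition wof (R : realType) (m n : nat) (A : 'M[R]_(m, n)) (c : 'cV[R]_n)
    (z : 'cV[R]_(n + m)) : 'cV[R]_(n + n) :=
  col_mx (usubmx z) (c - A^T *m dsubmx z).

Definition accepted (R : realType) (m n : nat) (A : 'M[R]_(m, n))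
    (b : 'cV[R]_m) (c : 'cV[R]_n) (eps_cons eps_gap : R)
    (z : 'cV[R]_(n + m)) : Prop :=
  Econs A b c (wof A c z) <= eps_cons /\ Egap A b c (wof A c z) <= eps_gap.

(* rPDHG reaches an accepted restart point, and T is the number of calls to
   [OnePDHG] made up to the first one (T is unique, the run being
   deterministic) *)
Definition total_iterations (R : realType) (m n : nat) (A : 'M[R]_(m, n))
    (b : 'cV[R]_m) (c : 'cV[R]_n) (tau sigma beta : R)
    (zinit : 'cV[R]_(n + m)) (eps_cons eps_gap : R) (T : nat) : Prop :=
  exists (N : nat) (z : nat -> 'cV[R]_(n + m)) (k : nat -> nat),
    [/\ rPDHG_run A b c tau sigma beta zinit N z k,
        accepted A b c eps_cons eps_gap (z N),
        forall j, (j < N)%N -> ~ accepted A b c eps_cons eps_gap (z j)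
      & T = (\sum_(j < N) k j)%N].

(* Main.v *)
(** Along an outer iteration the averaged PDHG iterate satisfies the ergodic
    estimate [2 k (L(xbar, yh) - L(xh, ybar)) <= |zh - z0|_M^2], so the
    normalized duality gap [rho] after [k] inner steps is at most
    [4 |z0 - z*|_M / k] for every saddle point [z*].  Conversely [rho] bounds
    the errors of [w = (x, s)]: the infeasibility is at most
    [sqrt kappa * rho] and the gap at most [2 |z*|_M rho].

    The two are linked by an error bound for linear programs.  For
    [delta <= best_gap] every feasible [w] is within [(D / delta) Gap w] of the
    optimal set; an infeasible point is first pulled towards a center of
    [W_delta] of conic radius [r], at a relative cost [D / r].  Since
    [r |w*| <= delta], this gives
    [|z - z*|_M <= sqrt 2 (3 + 2 sqrt 2) kappa (D / r) rho].  Hence each restart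
    costs at most [100 kappa D / r] inner steps and divides [rho] by [e].

    The optimal set is nonempty because the averages started at 0 are nearly
    feasible with nonpositive gap, and can be made feasible by moving slightly
    towards a strictly feasible point. *)

Require Import Defs.
From mathcomp Require Import ring lra.

Set Implicit Arguments.
Unset Strict Implicit.
Unset Printing Implicit Defensive.

Local Open Scope classical_set_scope.
Local Open Scope ring_scope.

(** * Euclidean geometry and seminorms *)

Section EuclideanGeometry.
Variable R : realType.

(** Since [c] lies in Null(A) and [A q = b], the gap on [V] is the complementarity product of x and
    s. This makes it nonnegative on the feasible set and lets it bound the norm of feasible points.
    The step sizes satisfy tau sigma lambda_max^2 = 1, the borderline case: [M] is only
    semidefinite, so all estimates use a seminorm. The rows of [A] may be dependent; the dual
    iterates are therefore kept in Im A, where A^T is bounded below by [lambda_min] and distances of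
    w = (x, s) control distances of z. At radius 0 the normalized gap takes the default value 0 and
    says nothing about errors. This case is removed by showing that an average which has not moved
    is already accepted. The number of outer iterations comes from two opposite bounds on [rho]: the
    restarts force geometric decay, while a restart point that is not accepted has [rho] bounded
    below in terms of the tolerances. *)

Lemma dotE d (u v : 'cV[R]_d) : dot u v = (u^T *m v) 0 0.
Proof. by rewrite /dot mxE; apply: eq_bigr => i _; rewrite mxE. Qed.

Lemma dotC d (u v : 'cV[R]_d) : dot u v = dot v u.
Proof. by apply: eq_bigr => i _; rewrite mulrC. Qed.

Lemma dotDr d (u v w : 'cV[R]_d) : dot u (v + w) = dot u v + dot u w.
Proof. by rewrite !dotE mulmxDr mxE. Qed.

Lemma dotZr d a (u v : 'cV[R]_d) : dot u (a *: v) = a * dot u v.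
Proof. by rewrite !dotE -scalemxAr mxE. Qed.

Lemma dotNr d (u v : 'cV[R]_d) : dot u (- v) = - dot u v.
Proof. by rewrite -scaleN1r dotZr mulN1r. Qed.

Lemma dotBr d (u v w : 'cV[R]_d) : dot u (v - w) = dot u v - dot u w.
Proof. by rewrite dotDr dotNr. Qed.

Lemma dotDl d (u v w : 'cV[R]_d) : dot (u + v) w = dot u w + dot v w.
Proof. by rewrite dotC dotDr !(dotC w). Qed.

Lemma dotZl d a (u v : 'cV[R]_d) : dot (a *: u) v = a * dot u v.
Proof. by rewrite dotC dotZr dotC. Qed.

Lemma dotNl d (u v : 'cV[R]_d) : dot (- u) v = - dot u v.
Proof. by rewrite dotC dotNr dotC. Qed.

Lemma dotBl d (u v w : 'cV[R]_d) : dot (u - v) w = dot u w - dot v w.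
Proof. by rewrite dotDl dotNl. Qed.

Lemma dot0r d (u : 'cV[R]_d) : dot u 0 = 0.
Proof. by rewrite -(scale0r 0) dotZr mul0r. Qed.

Lemma dot0l d (u : 'cV[R]_d) : dot 0 u = 0.
Proof. by rewrite dotC dot0r. Qed.

Definition dot_lin := (dotDl, dotDr, dotBl, dotBr, dotNl, dotNr, dotZl, dotZr,
  dot0l, dot0r).

Lemma dot_mulmxl m n (A : 'M[R]_(m, n)) u v : dot (A *m u) v = dot u (A^T *m v).
Proof. by rewrite !dotE trmx_mul mulmxA. Qed.

Lemma dot_mulmxr m n (A : 'M[R]_(m, n)) u v : dot u (A *m v) = dot (A^T *m u) v.
Proof. by rewrite dot_mulmxl trmxK. Qed.

Lemma dot_ge0 d (u : 'cV[R]_d) : 0 <= dot u u.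
Proof. by apply: sumr_ge0 => i _; rewrite -expr2 sqr_ge0. Qed.

Lemma dot_eq0 d (u : 'cV[R]_d) : (dot u u == 0) = (u == 0).
Proof.
apply/idP/eqP => [|->]; last by rewrite dot0l.
rewrite psumr_eq0 => [/allP u0|i _]; last by rewrite -expr2 sqr_ge0.
apply/colP => i; rewrite mxE; apply/eqP.
by have := u0 i (mem_index_enum _); rewrite mulf_eq0 orbb.
Qed.

Lemma dot_gt0 d (u : 'cV[R]_d) : (0 < dot u u) = (u != 0).
Proof. by rewrite lt0r dot_eq0 dot_ge0 andbT. Qed.

Lemma dot_nneg d (u v : 'cV[R]_d) : orthant u -> orthant v -> 0 <= dot u v.
Proof. by move=> u0 v0; apply: sumr_ge0 => i _; rewrite mulr_ge0. Qed.

Lemma dot_col_mx m n (u u' : 'cV[R]_m) (v v' : 'cV[R]_n) :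
  dot (col_mx u v) (col_mx u' v') = dot u u' + dot v v'.
Proof. by rewrite !dotE tr_col_mx mul_row_col mxE. Qed.

Lemma coord_sqr_le d (u : 'cV[R]_d) i : (u i 0) ^+ 2 <= dot u u.
Proof.
rewrite /dot (bigD1 i) //= expr2 lerDl; apply: sumr_ge0 => j _.
by rewrite -expr2 sqr_ge0.
Qed.

Definition psd d (P : 'M[R]_d) := P^T = P /\ forall z, 0 <= dot z (P *m z).

Definition snorm d (P : 'M[R]_d) (z : 'cV[R]_d) := Num.sqrt (dot z (P *m z)).

Lemma psd1 d : psd (1%:M : 'M[R]_d).
Proof. by split=> [|z]; rewrite ?trmx1 // mul1mx dot_ge0. Qed.

Lemma enormE d (u : 'cV[R]_d) : enorm u = snorm 1%:M u.
Proof. by rewrite /snorm mul1mx. Qed.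

Lemma snorm_ge0 d (P : 'M[R]_d) z : 0 <= snorm P z.
Proof. exact: sqrtr_ge0. Qed.

Lemma sqr_snorm d (P : 'M[R]_d) z : psd P -> snorm P z ^+ 2 = dot z (P *m z).
Proof. by case=> _ P0; rewrite sqr_sqrtr. Qed.

Lemma snormZ d (P : 'M[R]_d) a z : snorm P (a *: z) = `|a| * snorm P z.
Proof.
by rewrite /snorm -scalemxAr !dot_lin mulrA -expr2 sqrtrM ?sqr_ge0 // sqrtr_sqr.
Qed.

Lemma snormN d (P : 'M[R]_d) z : snorm P (- z) = snorm P z.
Proof. by rewrite -scaleN1r snormZ normrN1 mul1r. Qed.

Lemma snormC d (P : 'M[R]_d) u v : snorm P (u - v) = snorm P (v - u).
Proof. by rewrite -snormN opprB. Qed.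

Lemma snorm0 d (P : 'M[R]_d) : snorm P 0 = 0.
Proof. by rewrite -(scale0r 0) snormZ normr0 mul0r. Qed.

Lemma psd_dotC d (P : 'M[R]_d) u v : psd P -> dot u (P *m v) = dot v (P *m u).
Proof. by case=> PT _; rewrite dot_mulmxr PT dotC. Qed.

Lemma psd_dotD d (P : 'M[R]_d) u v : psd P ->
  dot (u + v) (P *m (u + v)) =
  dot u (P *m u) + 2 * dot u (P *m v) + dot v (P *m v).
Proof.
move=> Ppsd; rewrite mulmxDr !dot_lin (psd_dotC v u Ppsd).
by ring.
Qed.

(** The discriminant of the nonnegative quadratic t -> <u + t v, P (u + t v)>. As [P] may be
    singular, the leading coefficient can vanish; the quadratic is then affine and takes the value
    -1 unless [b = 0]. *)
Lemma psd_CauchySchwarz d (P : 'M[R]_d) u v : psd P ->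
  dot u (P *m v) <= snorm P u * snorm P v.
Proof.
move=> Ppsd; have [_ P0] := Ppsd.
have qt t : 0 <= dot u (P *m u) + 2 * t * dot u (P *m v) + t ^+ 2 * dot v (P *m v).
  have := P0 (u + t *: v); rewrite psd_dotD // -!scalemxAr !dot_lin.
  by rewrite !mulrA -expr2.
have u0 := P0 u; have v0 := P0 v.
move: u0 v0 qt; rewrite /snorm.
set a := dot u _; set b := dot u _; set c := dot v _ => a0 c0 qt.
rewrite -sqrtrM //; apply: le_trans (ler_norm b) _.
rewrite -sqrtr_sqr ler_wsqrtr //.
have [c_eq0|c_neq0] := eqVneq c 0.
  have [->|bn0] := eqVneq b 0; first by rewrite expr0n mulr_ge0.
  have := qt (- (a + 1) / (2 * b)); rewrite c_eq0 mulr0 addr0.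
  have -> : a + 2 * (- (a + 1) / (2 * b)) * b = - 1 by field.
  by rewrite lerNr oppr0 ler10.
have c_gt0 : 0 < c by rewrite lt0r c_neq0.
have := qt (- b / c).
have -> : a + 2 * (- b / c) * b + (- b / c) ^+ 2 * c = (a * c - b ^+ 2) / c.
  by field.
by rewrite pmulr_lge0 ?invr_gt0 // subr_ge0.
Qed.

Lemma snormD d (P : 'M[R]_d) u v : psd P ->
  snorm P (u + v) <= snorm P u + snorm P v.
Proof.
move=> Ppsd; rewrite -(@ler_pXn2r _ 2) ?nnegrE ?addr_ge0 ?snorm_ge0 //.
rewrite sqr_snorm // psd_dotD // sqrrD !sqr_snorm // lerD2r lerD2l.
by have := psd_CauchySchwarz u v Ppsd; lra.
Qed.

Lemma snormB_le d (P : 'M[R]_d) u v w : psd P ->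
  snorm P (u - w) <= snorm P (u - v) + snorm P (v - w).
Proof. by move=> Ppsd; rewrite -(subrKA v) snormD. Qed.

Lemma snorm_sum d (P : 'M[R]_d) (I : Type) (s : seq I) (F : I -> 'cV[R]_d) :
  psd P -> snorm P (\sum_(i <- s) F i) <= \sum_(i <- s) snorm P (F i).
Proof.
move=> Ppsd; elim: s => [|i s IH]; first by rewrite !big_nil snorm0.
by rewrite !big_cons (le_trans (snormD _ _ Ppsd)) // lerD2l.
Qed.

Lemma enorm_ge0 d (u : 'cV[R]_d) : 0 <= enorm u.
Proof. exact: sqrtr_ge0. Qed.

Lemma sqr_enorm d (u : 'cV[R]_d) : enorm u ^+ 2 = dot u u.
Proof. by rewrite sqr_sqrtr ?dot_ge0. Qed.

Lemma enormZ d a (u : 'cV[R]_d) : enorm (a *: u) = `|a| * enorm u.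
Proof. by rewrite !enormE snormZ. Qed.

Lemma enorm0 d : enorm (0 : 'cV[R]_d) = 0.
Proof. by rewrite enormE snorm0. Qed.

Lemma enormN d (u : 'cV[R]_d) : enorm (- u) = enorm u.
Proof. by rewrite !enormE snormN. Qed.

Lemma enormD d (u v : 'cV[R]_d) : enorm (u + v) <= enorm u + enorm v.
Proof. by rewrite !enormE snormD //; exact: psd1. Qed.

Lemma enormB_le d (u v w : 'cV[R]_d) :
  enorm (u - w) <= enorm (u - v) + enorm (v - w).
Proof. by rewrite !enormE snormB_le //; exact: psd1. Qed.

Lemma enorm_CauchySchwarz d (u v : 'cV[R]_d) : dot u v <= enorm u * enorm v.
Proof. by rewrite !enormE -{1}[v]mul1mx psd_CauchySchwarz //; exact: psd1. Qed.

Lemma enorm_eq0 d (u : 'cV[R]_d) : (enorm u == 0) = (u == 0).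
Proof. by rewrite sqrtr_eq0 -dot_eq0 eq_le dot_ge0 andbT. Qed.

Lemma enorm_gt0 d (u : 'cV[R]_d) : (0 < enorm u) = (u != 0).
Proof. by rewrite lt0r enorm_eq0 enorm_ge0 andbT. Qed.

Lemma coord_le_enorm d (u : 'cV[R]_d) i : `|u i 0| <= enorm u.
Proof.
by rewrite -sqrtr_sqr ler_wsqrtr // coord_sqr_le.
Qed.

Lemma enorm_le_sum d (u : 'cV[R]_d) : orthant u -> enorm u <= \sum_i u i 0.
Proof.
move=> u0; have s0 : 0 <= \sum_i u i 0 by apply: sumr_ge0.
rewrite -(@ler_pXn2r _ 2) ?nnegrE ?enorm_ge0 // sqr_enorm expr2 mulr_suml.
apply: ler_sum => i _; rewrite ler_wpM2l // (bigD1 i) //= lerDl.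
exact: sumr_ge0.
Qed.

Lemma enorm_col_mx m n (u : 'cV[R]_m) (v : 'cV[R]_n) :
  enorm (col_mx u v) ^+ 2 = enorm u ^+ 2 + enorm v ^+ 2.
Proof. by rewrite !sqr_enorm dot_col_mx. Qed.

Lemma enorm_col_mx_le m n (u : 'cV[R]_m) (v : 'cV[R]_n) :
  enorm (col_mx u v) <= enorm u + enorm v.
Proof.
rewrite -(@ler_pXn2r _ 2) ?nnegrE ?addr_ge0 ?enorm_ge0 // enorm_col_mx.
have := enorm_ge0 u; have := enorm_ge0 v; nra.
Qed.

End EuclideanGeometry.

(** * Minima on compact sets *)

Section CompactMinimum.
Variable R : realType.

Lemma continuous_sum (T : topologicalType) (I : finType) (f : I -> T -> R) :
  (forall i, continuous (f i)) -> continuous (fun u => \sum_i f i u).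
Proof.
move=> cf; rewrite /index_enum; elim: (Finite.enum I) => [|i s IH].
  rewrite (_ : (fun _ => _) = cst 0) => [x|]; first exact: cvg_cst.
  by apply/funext => u; rewrite big_nil.
under eq_fun do rewrite big_cons; by move=> x; exact: (cvgD (cf i x) (IH x)).
Qed.

Lemma continuous_prod (T : topologicalType) (f g : T -> R) :
  continuous f -> continuous g -> continuous (fun u => f u * g u).
Proof. by move=> cf cg x; exact: (cvgM (cf x) (cg x)). Qed.

Lemma continuous_mulmx_coord d e (H : 'M[R]_(e, d)) i :
  continuous (fun u : 'cV[R]_d => (H *m u) i 0).
Proof.
under eq_fun do rewrite mxE.
apply: continuous_sum => j; apply: continuous_prod; first exact: cst_continuous.
exact: coord_continuous.
Qed.

Lemma continuous_dot_mulmx d e (G H : 'M[R]_(e, d)) :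
  continuous (fun u : 'cV[R]_d => dot (G *m u) (H *m u)).
Proof.
by apply: continuous_sum => i; apply: continuous_prod; exact: continuous_mulmx_coord.
Qed.

Lemma continuous_dotl d (v : 'cV[R]_d) : continuous (dot v).
Proof.
apply: continuous_sum => j; apply: continuous_prod; first exact: cst_continuous.
exact: coord_continuous.
Qed.

Lemma closed_fun_eq (T : topologicalType) (f : T -> R) a :
  continuous f -> closed [set u | f u = a].
Proof. by move=> /continuous_closedP/(_ _ (@closed_eq _ a)). Qed.

Lemma closed_fun_le (T : topologicalType) (f : T -> R) a :
  continuous f -> closed [set u | f u <= a].
Proof. by move=> /continuous_closedP/(_ _ (@closed_le _ a)). Qed.

Lemma closed_mulmx_eq d e (H : 'M[R]_(e, d)) (v : 'cV[R]_e) :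
  closed [set u : 'cV[R]_d | H *m u = v].
Proof.
rewrite (_ : mkset _ = \bigcap_i [set u | (H *m u) i 0 = v i 0]).
  apply: closed_bigI => i _; apply: closed_fun_eq.
  exact: continuous_mulmx_coord.
apply/seteqP; split=> [u /= <- //|u /= Huv].
by apply/colP => i; exact: Huv.
Qed.

Lemma closed_mulmx_nneg d e (H : 'M[R]_(e, d)) :
  closed [set u : 'cV[R]_d | orthant (H *m u)].
Proof.
rewrite (_ : mkset _ = \bigcap_i [set u | (- H *m u) i 0 <= 0]).
  apply: closed_bigI => i _; apply: closed_fun_le.
  exact: continuous_mulmx_coord.
apply/seteqP; split=> u /= H0 i.
  by move=> _ /=; rewrite mulNmx mxE oppr_le0; exact: H0.
by have := H0 i I; rewrite /= mulNmx mxE oppr_le0.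
Qed.

Lemma closed_bounded_min d (S : set 'cV[R]_d) (f : 'cV[R]_d -> R) (B : R) :
  S !=set0 -> closed S -> (forall u, S u -> forall i, `|u i 0| <= B) ->
  continuous f -> exists2 u, S u & forall v, S v -> f u <= f v.
Proof.
move=> S0 Scl SB cf.
(* [rV_compact] speaks of row vectors; continuity of the transpose carries boxes over to columns. *)
have cT : continuous (@trmx R 1 d).
  move=> x P [Q nQ QP]; exists (fun i j => Q j i) => [i j|v Qv].
    by have := nQ j i; rewrite mxE.
  by apply: QP => i j; rewrite mxE; exact: Qv.
have cbox : compact [set u : 'cV[R]_d | forall i, u i 0 \in `[- B, B]].
  have := @rV_compact R d (fun=> `[- B, B]%classic) (fun=> @segment_compact _ _ _).
  move=> /(continuous_compact (continuous_subspaceT cT)).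
  congr compact; apply/seteqP; split=> [u /= [v vB <-] i|u /= uB].
    by rewrite mxE; exact: vB.
  by exists u^T; rewrite ?trmxK // => i; rewrite mxE; exact: uB.
have cS : compact S.
  apply: subclosed_compact Scl cbox _ => u /SB uB i.
  by rewrite in_itv /= -ler_norml.
have [u uS fu] := compact_EVT_min S0 cS (continuous_subspaceT cf).
by exists u => [|v Sv]; [rewrite inE in uS|apply: fu; rewrite inE].
Qed.

(* The gradient of the Rayleigh quotient vanishes at a minimizer on the unit
   sphere of the fixed space of [P], which [H] preserves. *)
Lemma min_eigenpair d (H P : 'M[R]_d) :
  H^T = H -> P *m H = H -> (exists2 u : 'cV[R]_d, u != 0 & P *m u = u) ->
  exists mu : R, exists u : 'cV[R]_d,
    [/\ u != 0, P *m u = u, H *m u = mu *: u &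
        forall v, P *m v = v -> mu * dot v v <= dot v (H *m v)].
Proof.
move=> HT PH [w w0 Pw].
pose S := [set u : 'cV[R]_d | dot u u = 1] `&` [set u | (P - 1%:M) *m u = 0].
have PS u : (P *m u = u) <-> ((P - 1%:M) *m u = 0).
  rewrite mulmxBl mul1mx; split=> [->|/eqP]; first by rewrite subrr.
  by rewrite subr_eq0 => /eqP.
have normalize v : v != 0 -> P *m v = v -> S ((enorm v)^-1 *: v).
  move=> v0 Pv; split=> /=; last by apply/PS; rewrite -scalemxAr Pv.
  by rewrite !dot_lin -sqr_enorm; field; rewrite enorm_eq0.
have dotS u : dot u u = dot (1%:M *m u) (1%:M *m u) by rewrite mul1mx.
have Scl : closed S.
  apply: closedI; last exact: closed_mulmx_eq.
  apply: closed_fun_eq.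
  under eq_fun do rewrite dotS.
  exact: continuous_dot_mulmx.
have SB u : S u -> forall i, `|u i 0| <= 1.
  move=> [/= u1 _] i; apply: le_trans (coord_le_enorm _ _) _.
  by rewrite /enorm u1 sqrtr1.
have cf : continuous (fun u : 'cV[R]_d => dot (1%:M *m u) (H *m u)).
  exact: continuous_dot_mulmx.
have S0 : S !=set0 by exists ((enorm w)^-1 *: w); exact: normalize.
have [u [/= u1 /PS Pu] umin] := closed_bounded_min S0 Scl SB cf.
rewrite !mul1mx in umin.
pose mu := dot u (H *m u).
have mumin v : P *m v = v -> mu * dot v v <= dot v (H *m v).
  move=> Pv; have [->|v0] := eqVneq v 0; first by rewrite dot0l dot0l mulr0.
  have := umin _ (normalize v v0 Pv).
  rewrite mul1mx -scalemxAr !dot_lin mulrA -/mu -expr2 exprVn sqr_enorm.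
  by rewrite ler_pdivlMl ?dot_gt0 // mulrC.
exists mu, u; split => //.
  by apply/eqP => u0; move: u1; rewrite u0 dot0l => /eqP; rewrite eq_sym oner_eq0.
have [h hE] : exists h, h = H *m u - mu *: u by exists (H *m u - mu *: u).
have Ph : P *m h = h by rewrite hE mulmxBr mulmxA PH -scalemxAr Pu.
have hh : dot h (H *m u) - mu * dot h u = dot h h.
  by rewrite {4}hE !dot_lin.
have qt t : 0 <= 2 * t * dot h h + t ^+ 2 * (dot h (H *m h) - mu * dot h h).
  have := mumin (u + t *: h); rewrite !mulmxDr -!scalemxAr Pu Ph => /(_ erefl).
  rewrite !dot_lin u1 -/mu -hh (dotC u h).
  rewrite (dot_mulmxr H u h) HT (dotC (H *m u)); lra.
apply/eqP; rewrite -subr_eq0 -hE -dot_eq0.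
have h0 := dot_ge0 h.
set g := dot h h in h0 qt *; set k := _ - _ in qt.
rewrite eq_le h0 andbT leNgt; apply/negP => g0.
have k0 : 0 < `|k| + 1 by rewrite ltr_wpDl.
(* A negative step, short enough for the linear term to dominate: the value has the sign of k - 2
   (|k| + 1) < 0. *)
have := qt (- g / (`|k| + 1)).
have -> : 2 * (- g / (`|k| + 1)) * g + (- g / (`|k| + 1)) ^+ 2 * k =
   g ^+ 2 * (k - 2 * (`|k| + 1)) / (`|k| + 1) ^+ 2.
  by field; rewrite gt_eqF.
rewrite pmulr_lge0 ?invr_gt0 ?exprn_gt0 // pmulr_rge0 ?exprn_gt0 //.
by have := ler_norm k; lra.
Qed.

End CompactMinimum.

(** * Moore-Penrose inverse and singular values *)

Section MoorePenrose.
Variable R : realType.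

Lemma trmx_mul_eq0 m n (A : 'M[R]_(m, n)) : A^T *m A = 0 -> A = 0.
Proof.
move=> AA; apply/matrixP => i j; rewrite mxE.
have : dot (col j A) (col j A) = (A^T *m A) j j.
  by rewrite mxE; apply: eq_bigr => k _; rewrite !mxE.
rewrite AA mxE => /eqP; rewrite dot_eq0 => /eqP/matrixP/(_ i 0).
by rewrite !mxE.
Qed.

Lemma row_free_gram r n (F : 'M[R]_(r, n)) : row_free F -> F *m F^T \in unitmx.
Proof.
move=> Ffree; rewrite -row_free_unit; apply: inj_row_free => v vFF.
apply/eqP; rewrite -(mulmx_free_eq0 v Ffree); apply/eqP.
apply: trmx_inj; rewrite trmx0; apply: trmx_mul_eq0.
by rewrite trmxK trmx_mul mulmxA -(mulmxA v) vFF mul0mx.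
Qed.

(** From a full-rank factorization A = C F, the inverse is F^T (F F^T)^-1 (C^T C)^-1 C^T. *)
Lemma mp_inverse_exists m n (A : 'M[R]_(m, n)) : exists B, is_mp_inverse A B.
Proof.
have [r [C [F [ACF Cfull Ffree]]]] : exists r (C : 'M[R]_(m, r)) (F : 'M[R]_(r, n)),
    [/\ A = C *m F, row_full C & row_free F].
  exists (\rank A), (col_base A), (row_base A).
  by rewrite mulmx_base col_base_full row_base_free.
have uF := row_free_gram Ffree.
have uC : C^T *m C \in unitmx.
  by rewrite -{2}[C]trmxK row_free_gram // /row_free mxrank_tr.
pose G := invmx (C^T *m C); pose H := invmx (F *m F^T).
have GT : G^T = G by rewrite trmx_inv trmx_mul trmxK.
have HT : H^T = H by rewrite trmx_inv trmx_mul trmxK.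
have GC p (Y : 'M[R]_(p, r)) : Y *m G *m C^T *m C = Y.
  by rewrite -!mulmxA mulVmx // mulmx1.
have FH p (Y : 'M[R]_(p, r)) : Y *m F *m F^T *m H = Y.
  by rewrite -!mulmxA (mulmxA F) mulmxV // mulmx1.
have AX : A *m (F^T *m H *m G *m C^T) = C *m G *m C^T.
  by rewrite ACF !mulmxA FH.
have XA : F^T *m H *m G *m C^T *m A = F^T *m H *m F.
  by rewrite ACF !mulmxA GC.
exists (F^T *m H *m G *m C^T); split.
- by rewrite AX ACF !mulmxA GC.
- by rewrite XA !mulmxA FH.
- by rewrite AX !trmx_mul GT trmxK mulmxA.
- by rewrite XA !trmx_mul HT trmxK mulmxA.
Qed.

Lemma mp_inverseP m n (A : 'M[R]_(m, n)) : is_mp_inverse A (mp_inverse A).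
Proof. by have [B ?] := mp_inverse_exists A; apply: (xgetPex 0); exists B. Qed.

(** The orthogonal projector onto Im(A^T), the space on which [lambda_min] is the smallest stretch
    factor of [A]. *)
Definition rowproj m n (A : 'M[R]_(m, n)) := A^T *m mp_inverse (A *m A^T) *m A.

(** The difference Y of the two sides satisfies Y A^T = 0 and has the form Z A, hence Y Y^T = 0. *)
Lemma mulmx_gram_mpK m n (A : 'M[R]_(m, n)) :
  A *m A^T *m mp_inverse (A *m A^T) *m A = A.
Proof.
have [GBG _ _ _] := mp_inverseP (A *m A^T).
set B := mp_inverse _ in GBG *; apply/eqP; rewrite -subr_eq0; apply/eqP.
have YA : (A *m A^T *m B *m A - A) *m A^T = 0.
  by rewrite mulmxBl -(mulmxA (_ *m B)) GBG subrr.
apply: trmx_inj; rewrite trmx0; apply: trmx_mul_eq0.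
rewrite trmxK; have {2}-> : A *m A^T *m B *m A - A = (A *m A^T *m B - 1%:M) *m A.
  by rewrite mulmxBl mul1mx.
by rewrite trmx_mul mulmxA YA mul0mx.
Qed.

Lemma rowproj_trmx m n (A : 'M[R]_(m, n)) : rowproj A *m A^T = A^T.
Proof.
have [GBG _ _ _] := mp_inverseP (A *m A^T).
rewrite /rowproj; set B := mp_inverse _ in GBG *.
apply/eqP; rewrite -subr_eq0; apply/eqP; apply: trmx_mul_eq0.
have -> : A^T *m B *m A *m A^T - A^T = A^T *m (B *m (A *m A^T) - 1%:M).
  by rewrite mulmxBr mulmx1 !mulmxA.
set D := _ - 1%:M.
have GD : A *m A^T *m D = 0 by rewrite mulmxBr mulmx1 (mulmxA (A *m A^T)) GBG subrr.
by rewrite trmx_mul trmxK -mulmxA (mulmxA A) GD mulmx0.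
Qed.

Lemma rowproj_idem m n (A : 'M[R]_(m, n)) : rowproj A *m rowproj A = rowproj A.
Proof. by rewrite {2}/rowproj !mulmxA rowproj_trmx. Qed.

End MoorePenrose.

(** * Extreme singular values as bounds on |A u| / |u| *)

Section SingularValues.
Variables (R : realType) (m n : nat) (A : 'M[R]_(m, n)).
Hypothesis A_neq0 : A != 0.

Local Notation lmin := (lambda_min A).
Local Notation lmax := (lambda_max A).
Local Notation P := (rowproj A).

Lemma pos_singular_valueP s : pos_singular_values A s ->
  exists u : 'cV[R]_n, [/\ 0 < s, u != 0, P *m u = u &
    dot (A *m u) (A *m u) = s ^+ 2 * dot u u].
Proof.
move=> [s0 /eigenvalueP[v vE v0]]; exists v^T.
have uE : A^T *m (A *m v^T) = s ^+ 2 *: v^T.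
  by apply: trmx_inj; rewrite mulmxA !trmx_mul !trmxK linearZ /= trmxK.
split => //.
- by apply: contra v0 => /eqP/(congr1 trmx); rewrite trmxK trmx0 => ->.
- have s20 : s ^+ 2 != 0 by rewrite expf_neq0 // gt_eqF.
  have -> : v^T = (s ^+ 2)^-1 *: (A^T *m (A *m v^T)).
    by rewrite uE scalerA mulVf // scale1r.
  by rewrite -scalemxAr [P *m _]mulmxA rowproj_trmx.
- by rewrite dot_mulmxl uE dotZr.
Qed.

Lemma eigen_pos_singular_values (mu : R) (u : 'cV[R]_n) : 0 < mu -> u != 0 ->
  A^T *m A *m u = mu *: u -> pos_singular_values A (Num.sqrt mu).
Proof.
move=> mu0 u0 uE; split; first by rewrite sqrtr_gt0.
rewrite sqr_sqrtr ?ltW //; apply/eigenvalueP; exists u^T; last first.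
  by apply: contra u0 => /eqP/(congr1 trmx); rewrite trmxK trmx0 => ->.
apply: trmx_inj; rewrite trmx_mul trmxK trmx_mul trmxK uE.
by rewrite linearZ /= trmxK.
Qed.

Lemma exists_mulmx_neq0 p q (B : 'M[R]_(p, q)) : B != 0 ->
  exists v : 'cV[R]_q, B *m v != 0.
Proof.
move=> B0; apply/not_existsP => Bv; case/negP: B0; apply/eqP/matrixP => i j.
have := Bv (delta_mx j 0); rewrite -colE => /negP/negPn/eqP/matrixP/(_ i 0).
by rewrite !mxE.
Qed.

(** Eigenvectors of A^T A for positive eigenvalues lie in Im(A^T). Minimizing the Rayleigh quotient
    on that space alone keeps the eigenvalue 0 of Null(A) away. *)
Lemma lambda_minP : 0 < lmin /\
  forall u : 'cV[R]_n, P *m u = u -> lmin * enorm u <= enorm (A *m u).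
Proof.
have AT0 : A^T != 0.
  by apply: contra A_neq0 => /eqP/(congr1 trmx); rewrite trmxK trmx0 => ->.
have [|||mu [u [u0 Pu uE umin]]] := @min_eigenpair R n (A^T *m A) P.
- by rewrite trmx_mul trmxK.
- by rewrite mulmxA rowproj_trmx.
- have [v v0] := exists_mulmx_neq0 AT0; exists (A^T *m v) => //.
  by rewrite mulmxA rowproj_trmx.
have muE : mu * dot u u = dot (A *m u) (A *m u).
  by rewrite dot_mulmxl mulmxA uE dotZr.
have mu0 : 0 < mu.
  have u_gt0 : 0 < dot u u by rewrite dot_gt0.
  rewrite -(pmulr_lgt0 _ u_gt0) muE dot_gt0; apply: contra u0 => /eqP Au0.
  by rewrite -Pu -mulmxA Au0 mulmx0.
have Smu := eigen_pos_singular_values mu0 u0 uE.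
have lb : lbound (pos_singular_values A) (Num.sqrt mu).
  move=> s /pos_singular_valueP[v [s0 v0 Pv vE]].
  have v_gt0 : 0 < dot v v by rewrite dot_gt0.
  rewrite -(ger0_norm (ltW s0)) -sqrtr_sqr ler_wsqrtr //.
  rewrite -(ler_pM2r v_gt0) -vE dot_mulmxl mulmxA; exact: umin.
have lminE : lmin = Num.sqrt mu.
  apply/le_anti/andP; split; last by apply: lb_le_inf => //; exists (Num.sqrt mu).
  by apply: ge_inf => //; exists (Num.sqrt mu).
rewrite lminE sqrtr_gt0; split=> // v Pv.
rewrite /enorm -sqrtrM ?(ltW mu0) // ler_wsqrtr // dot_mulmxl mulmxA; exact: umin.
Qed.

Lemma lambda_maxP (u : 'cV[R]_n) : enorm (A *m u) <= lmax * enorm u.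
Proof.
have [v0 Av0] := exists_mulmx_neq0 A_neq0.
(* The largest eigenvalue is obtained by minimizing for the negated matrix on the whole space. *)
have [|||mu [w [w0 Pw wE wmin]]] := @min_eigenpair R n (- (A^T *m A)) 1%:M.
- by rewrite linearN /= trmx_mul trmxK.
- by rewrite mul1mx.
- exists v0; last by rewrite mul1mx.
  by apply: contra Av0 => /eqP ->; rewrite mulmx0.
have Amu v : dot (A *m v) (A *m v) <= - mu * dot v v.
  have := wmin v; rewrite mul1mx mulNmx dotNr dot_mulmxl -mulmxA => /(_ erefl).
  by rewrite mulNr; lra.
have mu0 : 0 < - mu.
  rewrite ltNge; apply/negP => mu0.
  have := Amu v0; rewrite leNgt => /negP; apply.
  by rewrite (le_lt_trans _ (_ : 0 < _)) ?dot_gt0 // mulr_le0_ge0 // dot_ge0.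
have wE' : A^T *m A *m w = - mu *: w by rewrite scaleNr -wE mulNmx opprK.
have Smu := eigen_pos_singular_values mu0 w0 wE'.
have ub : ubound (pos_singular_values A) (Num.sqrt (- mu)).
  move=> s /pos_singular_valueP[v [s0 v_neq0 Pv vE]].
  have v_gt0 : 0 < dot v v by rewrite dot_gt0.
  rewrite -(ger0_norm (ltW s0)) -sqrtr_sqr ler_wsqrtr //.
  by rewrite -(ler_pM2r v_gt0) -vE Amu.
have lmaxE : lmax = Num.sqrt (- mu).
  apply/le_anti/andP; split; first by apply: ge_sup => //; exists (Num.sqrt (- mu)).
  by apply: ub_le_sup => //; exists (Num.sqrt (- mu)).
by rewrite lmaxE /enorm -sqrtrM ?(ltW mu0) // ler_wsqrtr // Amu.
Qed.

Lemma lambda_min_gt0 : 0 < lmin. Proof. exact: lambda_minP.1. Qed.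

Lemma lambda_min_le_max : lmin <= lmax.
Proof.
have AT0 : A^T != 0.
  by apply: contra A_neq0 => /eqP/(congr1 trmx); rewrite trmxK trmx0 => ->.
have [v v0] := exists_mulmx_neq0 AT0.
have u0 : 0 < enorm (A^T *m v) by rewrite enorm_gt0.
rewrite -(ler_pM2r u0); apply: le_trans (lambda_maxP _).
by apply: lambda_minP.2; rewrite mulmxA rowproj_trmx.
Qed.

Lemma lambda_max_gt0 : 0 < lmax.
Proof. exact: lt_le_trans lambda_min_gt0 lambda_min_le_max. Qed.

(** The same constant bounds A^T below on Im A: for u in Im(A^T), |A u|^2 = <u, A^T A u> <= |u| |A^T
    A u|, and |u| is at most |A u| / [lambda_min]. *)
Lemma lambda_min_trmx (v : 'cV[R]_n) :
  lmin * enorm (A *m v) <= enorm (A^T *m (A *m v)).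
Proof.
pose u := P *m v.
have Au : A *m u = A *m v by rewrite /u mulmxA /rowproj !mulmxA mulmx_gram_mpK.
have Pu : P *m u = u by rewrite /u mulmxA rowproj_idem.
have := lambda_minP.2 u Pu; rewrite Au => Hu.
have [->|Av0] := eqVneq (A *m v) 0; first by rewrite mulmx0 !enorm0 mulr0.
have u0 : 0 < enorm u.
  rewrite enorm_gt0; apply: contra Av0 => /eqP u0.
  by rewrite -Au u0 mulmx0.
have := enorm_CauchySchwarz u (A^T *m (A *m v)).
rewrite -dot_mulmxl Au -sqr_enorm => CS.
rewrite -(ler_pM2l u0); apply: le_trans CS.
by have := enorm_ge0 (A *m v); nra.
Qed.

End SingularValues.

(** * Geometry of the primal-dual feasible set *)

Section PrimalDualGeometry.
Variables (R : realType) (m n : nat) (A : 'M[R]_(m, n)).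
Variables (b : 'cV[R]_m) (c : 'cV[R]_n).
Hypothesis c_null : A *m c = 0.
Hypothesis b_im : exists x : 'cV[R]_n, A *m x = b.

Local Notation q := (qvec A b).
Local Notation V := (Vpd A b c).
Local Notation F := (feasible A b c).
Local Notation gap := (Gap A b c).

Lemma mulmx_qvec : A *m q = b.
Proof.
by have [x <-] := b_im; rewrite /qvec !mulmxA -2!(mulmxA (A *m _)) !mulmxA mulmx_gram_mpK.
Qed.

Lemma dot_trmx_null v : dot (A^T *m v) c = 0.
Proof. by rewrite dot_mulmxl trmxK c_null dot0r. Qed.

Lemma GapE w : gap w = dot (col_mx c q) w.
Proof. by rewrite -{2}[w]vsubmxK dot_col_mx. Qed.

Lemma Gap_dual x y : gap (col_mx x (c - A^T *m y)) = dot c x - dot b y.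
Proof.
rewrite GapE dot_col_mx dotBr dot_mulmxr trmxK mulmx_qvec.
by rewrite dot_trmx_null sub0r.
Qed.

(** For s = c + A^T y, both <x, s> - <c, x> and <q, s> equal <b, y>, because A x = A q = b and q is
    orthogonal to c. *)
Lemma dot_Vpd u v : V u -> V v ->
  dot (usubmx u) (dsubmx v) = dot c (usubmx u) + dot q (dsubmx v).
Proof.
move=> [ux _] [_ [y _ <-]]; rewrite !dotDr !(dot_mulmxr A^T) !trmxK ux.
by rewrite mulmx_qvec dot_trmx_null add0r dotC.
Qed.

Lemma Gap_Vpd w : V w -> gap w = dot (usubmx w) (dsubmx w).
Proof. by move=> Vw; rewrite dot_Vpd. Qed.

Lemma Kpd_orthant (w : 'cV[R]_(n + n)) : Kpd w <-> orthant w.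
Proof.
split=> [[xw sw] i|w0]; last by split=> i; rewrite mxE; exact: w0.
by case: (split_ordP i) => j ->; [have := xw j|have := sw j]; rewrite mxE.
Qed.

Lemma Vpd_comb t u v : V u -> V v -> V (t *: u + (1 - t) *: v).
Proof.
move=> [ux [yu _ us]] [vx [yv _ vs]]; split; rewrite /Vp /Vd /= linearD !linearZ /=.
  rewrite mulmxDr -!scalemxAr ux vx -scalerDl.
  by rewrite (_ : t + (1 - t) = 1) ?scale1r //; ring.
exists (t *: yu + (1 - t) *: yv) => //; rewrite -us -vs mulmxDr -!scalemxAr.
by apply/colP => i; rewrite !mxE; ring.
Qed.

Lemma feasible_comb t u v : 0 <= t <= 1 -> F u -> F v ->
  F (t *: u + (1 - t) *: v).
Proof.
move=> /andP[t0 t1] [Vu /Kpd_orthant u0] [Vv /Kpd_orthant v0].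
split; first exact: Vpd_comb.
apply/Kpd_orthant => i; rewrite !mxE addr_ge0 // mulr_ge0 ?subr_ge0 //.
Qed.

Lemma Gap_comb t u v : gap (t *: u + (1 - t) *: v) = t * gap u + (1 - t) * gap v.
Proof. by rewrite !GapE !dot_lin. Qed.

Lemma Gap_ge0 w : F w -> 0 <= gap w.
Proof. by move=> [Vw [x0 s0]]; rewrite Gap_Vpd // dot_nneg. Qed.

Lemma Gap_add u v : V u -> V v ->
  gap u + gap v = dot u (col_mx (dsubmx v) (usubmx v)).
Proof.
move=> Vu Vv; rewrite -{2}[u]vsubmxK dot_col_mx dot_Vpd // dotC.
by rewrite (dotC (dsubmx u)) dotC dot_Vpd // /Gap; ring.
Qed.

(* For [u], [v] in [V] the differences of the primal and the dual parts are
   orthogonal, so [Gap u + Gap v] is the cross product of the two points. *)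
Lemma sum_le_Gap r u v : F u -> F v -> (forall i, r <= v i 0) ->
  r * \sum_i u i 0 <= gap u + gap v.
Proof.
move=> [Vu /Kpd_orthant u0] [Vv _] vr; rewrite Gap_add // mulr_sumr.
apply: ler_sum => i _; rewrite mulrC ler_wpM2l //.
by case: (split_ordP i) => j ->; rewrite ?col_mxEu ?col_mxEd mxE.
Qed.

Lemma enorm_le_Gap r u v : 0 < r -> F u -> F v -> (forall i, r <= v i 0) ->
  r * enorm u <= gap u + gap v.
Proof.
move=> r0 Fu Fv vr; apply: le_trans (sum_le_Gap Fu Fv vr).
by rewrite ler_pM2l // enorm_le_sum //; apply/Kpd_orthant; case: Fu.
Qed.

(** The distance to the boundary of the orthant is the smallest coordinate. This turns the conic
    radius into a coordinatewise lower bound, the form used everywhere below. *)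
Lemma eball_coord r (w : 'cV[R]_(n + n)) : 0 <= r ->
  (eball w r `<=` @Kpd R n) <-> (forall i, r <= w i 0).
Proof.
move=> r0; split=> [wK i|wr v /= vw].
  have : @Kpd R n (w - r *: delta_mx i 0).
    apply: wK; rewrite /eball /= (_ : _ - w = - r *: delta_mx i 0); last first.
      by rewrite addrAC subrr add0r scaleNr.
    rewrite enormZ normrN ger0_norm // ler_piMr //.
    rewrite (le_trans (enorm_le_sum _)) => // [j|].
      by rewrite mxE; case: (_ && _); rewrite ?ler01.
    rewrite (bigD1 i) //= big1 ?mxE ?eqxx ?addr0 // => j ji.
    by rewrite mxE (negbTE ji).
  move=> /Kpd_orthant/(_ i); rewrite !mxE !eqxx mulr1; lra.
apply/Kpd_orthant => i.
have := coord_le_enorm (v - w) i; rewrite !mxE => vwi.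
have := le_trans vwi vw; rewrite ler_norml => /andP[].
by have := wr i; lra.
Qed.

(** * Sharpness of the gap and the error bound *)

Section Sharpness.
Variables (wr : 'cV[R]_(n + n)) (r : R).
Hypothesis r_gt0 : 0 < r.
Hypothesis Fwr : F wr.
Hypothesis wr_ge : forall i, r <= wr i 0.
Variables (delta D : R).
Hypothesis delta_gt0 : 0 < delta.
Hypothesis delta_le : (delta%:E <= best_gap A b c)%E.
Hypothesis diam : forall u v, Wlevel A b c delta u -> Wlevel A b c delta v ->
  enorm (u - v) <= D.
Variable w0 : 'cV[R]_(n + n).
Hypothesis opt0 : Wopt A b c w0.

Let D_ge0 : 0 <= D.
Proof.
have W0 : Wlevel A b c delta w0.
  by case: opt0 => Fw0 /= g0; split=> //=; rewrite g0 ltW.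
by rewrite (le_trans _ (diam W0 W0)) // enorm_ge0.
Qed.

(** A witness [ws] replaces [dist], so attainment of the infimum is not an issue and witnesses can
    be combined convexly. *)
Definition sharp w := exists2 ws, Wopt A b c ws & enorm (w - ws) <= D / delta * gap w.

(** The point of the segment from [w0] to [w] whose gap is exactly [delta] is within [D] of [w0];
    rescaling the segment gives the ratio. *)
Lemma sharp_far w : F w -> delta <= gap w -> sharp w.
Proof.
move=> Fw dw; exists w0 => //; case: opt0 => Fw0 /= g0.
have gw0 : 0 < gap w by exact: lt_le_trans dw.
pose t := delta / gap w.
have t01 : 0 <= t <= 1.
  by rewrite /t divr_ge0 ?(ltW gw0) ?(ltW delta_gt0) //= ler_pdivrMr // mul1r.
have W0 : Wlevel A b c delta w0 by split=> //=; rewrite g0 ltW.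
have Wt : Wlevel A b c delta (t *: w + (1 - t) *: w0).
  split; first exact: feasible_comb.
  by rewrite /= Gap_comb g0 mulr0 addr0 divfK // gt_eqF.
have -> : w - w0 = t^-1 *: (t *: w + (1 - t) *: w0 - w0).
  apply/colP => i; rewrite !mxE /t; field.
  by rewrite !gt_eqF.
rewrite enormZ ger0_norm ?invr_ge0; last by case/andP: t01.
rewrite invf_div mulrC mulrAC -mulrA ler_wpM2r ?diam //.
by rewrite divr_ge0 ?ltW.
Qed.

Lemma sharp_comb t u v : 0 <= t <= 1 -> sharp u -> sharp v ->
  sharp (t *: u + (1 - t) *: v).
Proof.
move=> t01 [us [Fus /= gus] uus] [vs [Fvs /= gvs] vvs].
exists (t *: us + (1 - t) *: vs).
  split; first exact: feasible_comb.
  by rewrite /= Gap_comb gus gvs !mulr0 addr0.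
have -> : t *: u + (1 - t) *: v - (t *: us + (1 - t) *: vs) =
  t *: (u - us) + (1 - t) *: (v - vs).
  by apply/colP => i; rewrite !mxE; ring.
apply: le_trans (enormD _ _) _; case/andP: t01 => t0 t1.
rewrite !enormZ !ger0_norm ?subr_ge0 // Gap_comb mulrDr.
rewrite (mulrCA _ t) (mulrCA _ (1 - t)).
by apply: lerD; apply: ler_wpM2l; rewrite ?subr_ge0.
Qed.

Definition supp (w : 'cV[R]_(n + n)) := [set i | w i 0 != 0]%SET.

(** If some coordinate of [d] is negative, the ratio test stops where the first coordinate vanishes,
    which shrinks the support since [d] vanishes wherever [w] does. Otherwise [d >= 0] and the
    coordinate sum, hence the gap, grows without bound. *)
Lemma sharp_ray w d : F w -> (forall t, V (w + t *: d)) -> d != 0 ->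
  (forall i, w i 0 = 0 -> d i 0 = 0) ->
  (forall v, F v -> (#|supp v| < #|supp w|)%N -> sharp v) ->
  exists2 t, 0 < t & sharp (w + t *: d).
Proof.
move=> Fw Vwd d0 wd IH; have [Vw /Kpd_orthant w_ge0] := Fw.
have w_gt0 i : d i 0 != 0 -> 0 < w i 0.
  by move=> di; rewrite lt0r w_ge0 andbT; apply: contra di => /eqP/wd ->.
have [[i0 di0]|dN] := pselect (exists i, d i 0 < 0).
  case: (@arg_minP _ _ _ i0 (fun i => d i 0 < 0) (fun i => w i 0 / - d i 0) di0).
  move=> i di imin; set t := w i 0 / - d i 0 in imin *.
  have t0 : 0 < t by rewrite divr_gt0 ?oppr_gt0 // w_gt0 // lt_eqF.
  exists t => //.
  have wt : F (w + t *: d).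
    split=> //; apply/Kpd_orthant => j; rewrite !mxE.
    have [dj|dj] := ltP (d j 0) 0; last by rewrite addr_ge0 // mulr_ge0 // ltW.
    have := imin j dj; rewrite ler_pdivlMr ?oppr_gt0 //; lra.
  apply: IH => //; apply: proper_card; apply/properP; split.
    apply/fintype.subsetP => j; rewrite !inE; apply: contra => /eqP wj.
    by rewrite !mxE wj (wd _ wj) mulr0 addr0.
  exists i; rewrite !inE; first by rewrite gt_eqF // w_gt0 // lt_eqF.
  by rewrite negbK !mxE /t; apply/eqP; field; rewrite lt_eqF.
have d_ge0 i : 0 <= d i 0 by rewrite leNgt; apply/negP => di; apply: dN; exists i.
have [i di] : exists i, d i 0 != 0.
  apply/not_existsP => dz; case/eqP: d0; apply/colP => i.
  by rewrite mxE; apply/eqP; have /negP := dz i; rewrite negbK.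
have s0 : 0 < \sum_i d i 0.
  rewrite (bigD1 i) //= ltr_wpDr ?sumr_ge0 //.
  by rewrite lt0r di d_ge0.
(* [sum_le_Gap] loses the summand [gap wr], so the sum is pushed far enough to leave [delta] after
   subtracting it. *)
pose t := (delta + gap wr) / (r * \sum_i d i 0).
have gwr := Gap_ge0 Fwr.
have t0 : 0 < t by rewrite divr_gt0 ?mulr_gt0 // ltr_wpDr.
exists t => //.
have wt : F (w + t *: d).
  split=> //; apply/Kpd_orthant => j; rewrite !mxE addr_ge0 // mulr_ge0 //.
  exact: ltW.
apply: sharp_far => //.
have := sum_le_Gap wt Fwr wr_ge; under eq_bigr do rewrite !mxE.
rewrite big_split /= -mulr_sumr mulrDr.
have -> : r * (t * \sum_i d i 0) = delta + gap wr.
  by rewrite /t; field; rewrite !gt_eqF.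
have : 0 <= r * \sum_i w i 0 by rewrite mulr_ge0 ?sumr_ge0 // ltW.
lra.
Qed.

(* A point of small gap that is not optimal is not extreme: moving both ways
   along a line either kills a coordinate or raises the gap to [delta], and
   [sharp] is preserved by convex combinations. *)
Lemma sharpness w : F w -> sharp w.
Proof.
have [k] := ubnP #|supp w|; elim: k w => // k IH w wk Fw.
have [|gw] := leP delta (gap w); first exact: sharp_far.
have [wopt|wNopt] := pselect (Wopt A b c w).
  exists w => //; rewrite subrr enorm0 mulr_ge0 ?divr_ge0 //; first exact: ltW.
  exact: Gap_ge0.
have wNext : ~ extreme_points F w.
  move=> wext; have : (best_gap A b c <= (gap w)%:E)%E.
    by apply: ereal_inf_lbound; exists w.
  by move=> /(le_trans delta_le); rewrite lee_fin leNgt gw.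
have [u [v [t [Fu Fv t01 wE uv]]]] : exists u v t,
    [/\ F u, F v, 0 < t < 1, w = t *: u + (1 - t) *: v & u <> v].
  apply/not_existsP => H; apply: wNext; split=> // u v t Fu Fv t01 wE.
  by apply: contrapT => uv; apply: (H u); exists v, t.
have [t0 t1] := andP t01.
pose d := u - v.
have d_neq0 : d != 0 by rewrite subr_eq0; apply/eqP.
have line a : w + a *: d = (t + a) *: u + (1 - (t + a)) *: v.
  by rewrite wE; apply/colP => i; rewrite !mxE; ring.
have wd i : w i 0 = 0 -> d i 0 = 0.
  have [_ /Kpd_orthant/(_ i) u0] := Fu; have [_ /Kpd_orthant/(_ i) v0] := Fv.
  rewrite wE !mxE => /eqP; rewrite paddr_eq0 ?mulr_ge0 ?subr_ge0 ?(ltW t0) ?(ltW t1) //.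
  rewrite !mulf_eq0 subr_eq0 (gt_eqF t0) (gt_eqF t1) /=.
  by move=> /andP[/eqP -> /eqP ->]; rewrite subrr.
have IHw x : F x -> (#|supp x| < #|supp w|)%N -> sharp x.
  by move=> Fx xw; apply: IH => //; apply: leq_trans xw _.
have Vline a : V (w + a *: d) by rewrite line; apply: Vpd_comb; [case: Fu|case: Fv].
have [t1' t1'0 s1] := sharp_ray Fw Vline d_neq0 wd IHw.
have [||||t2 t20 s2] := @sharp_ray w (- d) Fw.
- by move=> a; rewrite scalerN -scaleNr.
- by rewrite oppr_eq0.
- by move=> i wi; rewrite mxE (wd i wi) oppr0.
- exact: IHw.
have -> : w = (t2 / (t1' + t2)) *: (w + t1' *: d)
            + (1 - t2 / (t1' + t2)) *: (w + t2 *: - d).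
  by apply/colP => i; rewrite !mxE; field; rewrite gt_eqF // addr_gt0.
apply: sharp_comb => //.
have t12 := addr_gt0 t1'0 t20.
by rewrite divr_ge0 ?(ltW t20) ?(ltW t12) //= ler_pdivrMr // mul1r lerDr ltW.
Qed.

(** Weighting [wr] by [a = e / r] against [w] restores nonnegativity. Two terms [a * D] result: one
    from the gap of [wr], at most [delta], and one from its distance to the optimal point. *)
Lemma error_bound w e : V w -> 0 <= e -> (forall i, - e <= w i 0) ->
  gap wr <= delta ->
  exists2 ws, Wopt A b c ws &
    enorm (w - ws) <= D / delta * Num.max 0 (gap w) + 2 * (e / r) * D.
Proof.
move=> Vw e0 we gwr; pose a := e / r.
have a0 : 0 <= a by rewrite divr_ge0 // ltW.
have a1 : 0 < 1 + a by lra.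
pose t := (1 + a)^-1.
have [wt wtE] : exists wt, wt = t *: w + (1 - t) *: wr.
  by exists (t *: w + (1 - t) *: wr).
have Fwt : F wt.
  rewrite wtE; split; first by apply: Vpd_comb => //; case: Fwr.
  apply/Kpd_orthant => i; rewrite !mxE.
  have -> : t * w i 0 + (1 - t) * wr i 0 = (w i 0 + a * wr i 0) / (1 + a).
    by rewrite /t; field; rewrite gt_eqF.
  rewrite divr_ge0 ?(ltW a1) //.
  have : a * r <= a * wr i 0 by rewrite ler_wpM2l.
  have -> : a * r = e by rewrite divfK // gt_eqF.
  by have := we i; lra.
have [ws opts wsP] := sharpness Fwt; exists ws => //.
have wE : w - ws = (1 + a) *: (wt - ws) + a *: (ws - wr).
  rewrite wtE; apply/colP => i; rewrite !mxE /t; field.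
  by rewrite gt_eqF.
have gE : (1 + a) * gap wt = gap w + a * gap wr.
  by rewrite wtE Gap_comb /t; field; rewrite gt_eqF.
have Wr : Wlevel A b c delta wr by [].
have Ws : Wlevel A b c delta ws.
  by case: opts => Fws /= g0; split=> //=; rewrite g0 ltW.
rewrite wE; apply: le_trans (enormD _ _) _; rewrite !enormZ !ger0_norm ?(ltW a1) //.
have h1 : (1 + a) * enorm (wt - ws) <= D / delta * (gap w + a * gap wr).
  by rewrite -gE (mulrCA _ (1 + a)) ler_pM2l.
have h2 : a * enorm (ws - wr) <= a * D by rewrite ler_wpM2l // diam.
have Dd : 0 <= D / delta by rewrite divr_ge0 // ltW.
have h3 : D / delta * gap w <= D / delta * Num.max 0 (gap w).
  by rewrite ler_wpM2l // le_max lexx orbT.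
have h4 : D / delta * (a * gap wr) <= a * D.
  have -> : a * D = D / delta * (a * delta) by field; rewrite gt_eqF.
  by rewrite ler_wpM2l // ler_wpM2l.
rewrite -/a; lra.
Qed.

End Sharpness.

(** An extreme point is determined by its support: going slightly beyond [u] away from [v] stays
    feasible, and [u] would lie strictly between that point and [v]. The sum in [M] bounds every
    ratio v_i / u_i; terms with u_i = 0 count as 0. *)
Lemma extreme_points_supp u v : extreme_points F u -> F v ->
  supp v \subset supp u -> u = v.
Proof.
move=> [Fu uext] Fv vu.
have [_ /Kpd_orthant u0] := Fu; have [Vv /Kpd_orthant v0] := Fv.
pose M := \sum_i v i 0 / u i 0 + 1.
have Ms : 0 <= \sum_i v i 0 / u i 0 by apply: sumr_ge0 => i _; rewrite divr_ge0.
have M0 : 0 < M by rewrite /M; lra.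
pose a := M^-1; have a0 : 0 < a by rewrite invr_gt0.
pose p := (1 + a) *: u + (1 - (1 + a)) *: v.
have Fp : F p.
  split; first by apply: Vpd_comb => //; case: Fu.
  apply/Kpd_orthant => i; rewrite !mxE.
  suff : a * v i 0 <= u i 0 by have := u0 i; have := v0 i; nra.
  have [ui|ui] := eqVneq (u i 0) 0.
    have : i \notin supp v.
      by apply/negP => /(fintype.subsetP vu); rewrite inE ui eqxx.
    by rewrite inE negbK => /eqP ->; rewrite mulr0.
  rewrite /a mulrC ler_pdivrMr // mulrC -ler_pdivrMr ?lt0r ?ui ?u0 //.
  rewrite /M (bigD1 i) //= -addrA lerDl addr_ge0 // sumr_ge0 // => j _.
  by rewrite divr_ge0.
have : p = v.
  apply: (uext p v (1 + a)^-1) => //.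
    by rewrite invr_gt0 invf_lt1 ?ltrDl; lra.
  by apply/colP => i; rewrite !mxE; field; rewrite gt_eqF //; lra.
move=> /colP pv; apply/colP => i; have := pv i; rewrite !mxE.
move=> pvi; have : (1 + a) * (u i 0 - v i 0) = 0 by lra.
by move=> /eqP; rewrite mulf_eq0 gt_eqF ?subr_eq0 /= => [/eqP //|]; lra.
Qed.

(** There is at most one extreme point per support, so only finitely many positive gaps compete. The
    initial value 1 serves the case where there are none. *)
Lemma best_gap_gt0 : exists2 delta : R, 0 < delta & (delta%:E <= best_gap A b c)%E.
Proof.
pose E := extreme_points F `\` Wopt A b c.
have [delta d0 dP] : exists2 delta : R, 0 < delta &
    forall u, E u -> supp u \in enum [set: {set 'I_(n + n)}] -> delta <= gap u.
  elim: (enum _) => [|S s [delta d0 IH]]; first by exists 1.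
  have [[v [[vext vN] vS]]|nv] := pselect (exists v, E v /\ supp v = S).
    have gv : 0 < gap v.
      case: vext => Fv _; rewrite lt0r Gap_ge0 // andbT.
      by apply/eqP => g0; apply: vN.
    exists (Num.min delta (gap v)) => [|u Eu]; first by rewrite lt_min d0.
    rewrite inE => /orP[/eqP uS|us]; last by rewrite ge_min IH.
    have -> : u = v.
      apply: extreme_points_supp; [by case: Eu|by case: vext|].
      by rewrite uS vS.
    by rewrite ge_min lexx orbT.
  exists delta => // u Eu; rewrite inE => /orP[/eqP uS|]; last exact: IH.
  by case: nv; exists u.
exists delta => //; apply/ereal_infP => _ [u Eu <-]; rewrite lee_fin dP //.
by rewrite mem_enum inE.
Qed.

End PrimalDualGeometry.

(** * One outer iteration of PDHG *)

Section Projection.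
Variables (R : realType) (n : nat).

Lemma proj_orthantP (x : 'cV[R]_n) : orthant (proj (@orthant R n) x) /\
  forall u, orthant u ->
    dot (x - proj (@orthant R n) x) (u - proj (@orthant R n) x) <= 0.
Proof.
pose p : 'cV[R]_n := \col_i Num.max 0 (x i 0).
have p0 : orthant p by move=> i; rewrite mxE le_max lexx.
have pvar u : orthant u -> dot (x - p) (u - p) <= 0.
  move=> u0; apply: sumr_le0 => i _; rewrite !mxE.
  by have := u0 i; case: (leP 0 (x i 0)); nra.
have pyth u : enorm (x - u) ^+ 2 =
    enorm (x - p) ^+ 2 - 2 * dot (x - p) (u - p) + enorm (u - p) ^+ 2.
  have -> : x - u = (x - p) - (u - p) by rewrite opprB addrA subrK.
  rewrite !sqr_enorm; move: (x - p) (u - p) => a d.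
  by rewrite !dot_lin (dotC d); ring.
have pnear : is_nearest (@orthant R n) x p.
  split=> // u u0; rewrite -(@ler_pXn2r _ 2) ?nnegrE ?enorm_ge0 // (pyth u).
  by have := pvar u u0; have := sqr_ge0 (enorm (u - p)); lra.
suff -> : proj (@orthant R n) x = p by [].
have [p'0 p'near] : is_nearest (@orthant R n) x (proj (@orthant R n) x).
  by apply: (xgetPex 0); exists p.
(* Uniqueness: being no farther from [x] than [p], together with the variational inequality at [p],
   forces |p' - p| = 0. *)
have := p'near p p0; rewrite -(@ler_pXn2r _ 2) ?nnegrE ?enorm_ge0 // pyth.
have := pvar _ p'0; set p' := proj _ _ => h1 h2.
apply/eqP; rewrite -subr_eq0 -enorm_eq0 -sqrf_eq0 eq_le sqr_ge0 andbT.
by lra.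
Qed.

End Projection.

Section PDHG.
Variables (R : realType) (m n : nat) (A : 'M[R]_(m, n)).
Variables (b : 'cV[R]_m) (c : 'cV[R]_n) (tau sigma : R).
Hypothesis tau_gt0 : 0 < tau.
Hypothesis sigma_gt0 : 0 < sigma.

Local Notation M := (Mmx A tau sigma).
Hypothesis M_psd : psd M.

Local Notation step := (OnePDHG A b c tau sigma).
Local Notation avg := (avg_iter A b c tau sigma).

Definition saddle_gap (z zh : 'cV[R]_(n + m)) : R :=
  Lagr A b c (usubmx z) (dsubmx zh) - Lagr A b c (usubmx zh) (dsubmx z).

Lemma saddle_gapE z zh : saddle_gap z zh =
  dot (b - A *m usubmx z) (dsubmx zh - dsubmx z)
  - dot (c - A^T *m dsubmx z) (usubmx zh - usubmx z).
Proof.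
by rewrite /saddle_gap /Lagr !dot_lin !(dotC (A^T *m _)) !dot_mulmxl; ring.
Qed.

(** The bilinear terms in [z] cancel, so for fixed [zh] the gap of an average is the average of the
    gaps. *)
Lemma saddle_gap_affine z zh : saddle_gap z zh =
  dot b (dsubmx zh) - dot c (usubmx zh)
  + dot (col_mx (c - A^T *m dsubmx zh) (A *m usubmx zh - b)) z.
Proof.
rewrite -{2}[z]vsubmxK dot_col_mx /saddle_gap /Lagr !dot_lin.
rewrite (dotC (A^T *m dsubmx zh)) (dot_mulmxl A) ; ring.
Qed.

(** A PDHG step is a proximal point step in the metric [M]. [core] is its variational inequality;
    the three-point identity then yields the claim after dropping |z - z1|_M^2. *)
Lemma OnePDHG_gap z zh : orthant (usubmx zh) ->
  2 * saddle_gap (step z) zh <=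
  snorm M (zh - z) ^+ 2 - snorm M (zh - step z) ^+ 2.
Proof.
move=> zh0; pose z1 := step z.
have [x1_0 x1_var] := proj_orthantP (usubmx z - tau *: (c - A^T *m dsubmx z)).
have x1E : usubmx z1 = proj (@orthant R n) (usubmx z - tau *: (c - A^T *m dsubmx z)).
  by rewrite /z1 /OnePDHG col_mxKu.
have y1E : dsubmx z1 =
    dsubmx z + sigma *: (b - A *m (2%:R *: usubmx z1 - usubmx z)).
  by rewrite x1E /z1 /OnePDHG col_mxKd.
rewrite -x1E in x1_0 x1_var.
have core : dot (zh - z1) (M *m (z - z1)) <= - saddle_gap z1 zh.
  have zE v : v = col_mx (usubmx v) (dsubmx v) by rewrite vsubmxK.
  have uB (u v : 'cV[R]_(n + m)) : usubmx (u - v) = usubmx u - usubmx v.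
    exact: linearB.
  have dB (u v : 'cV[R]_(n + m)) : dsubmx (u - v) = dsubmx u - dsubmx v.
    exact: linearB.
  rewrite [zh - z1]zE [z - z1]zE mul_block_col dot_col_mx !uB !dB.
  (* The extrapolation 2 x1 - x is what lets the off-diagonal block of [M] cancel [A *m x], leaving
     the residual at [x1] alone. *)
  have y1E' : sigma^-1 *: (dsubmx z - dsubmx z1) =
      A *m (2%:R *: usubmx z1 - usubmx z) - b.
    rewrite y1E opprD addrA subrr sub0r -scalerN scalerA mulVf ?gt_eqF //.
    by rewrite scale1r opprB.
  rewrite !mul_scalar_mx y1E' !mulmxBr.
  have := x1_var _ zh0; set xh := usubmx zh; set yh := dsubmx zh.
  rewrite saddle_gapE -/xh -/yh.
  set x1 := usubmx z1; set y1 := dsubmx z1; set x := usubmx z; set y := dsubmx z.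
  move=> H.
  have -> : A *m x - A *m x1 + (A *m (2%:R *: x1) - A *m x - b) = - (b - A *m x1).
    rewrite -scalemxAr; apply/colP => i; rewrite !mxE; ring.
  rewrite dotNr (dotC (yh - y1)) (dotDr (xh - x1)) dotZr.
  have {H} : tau^-1 * dot (x - tau *: (c - A^T *m y) - x1) (xh - x1) <= 0.
    by rewrite pmulr_rle0 ?invr_gt0.
  have -> : x - tau *: (c - A^T *m y) - x1 = (x - x1) - tau *: (c - A^T *m y).
    by rewrite addrAC.
  rewrite (dotBl (x - x1)) (dotZl tau) mulrBr mulKf ?gt_eqF //.
  rewrite !(dotC (xh - x1)) (dotBl (A^T *m y)) !(dotBl c); lra.
have := psd_dotD (zh - z1) (- (z - z1)) M_psd.
rewrite mulmxN !dotNr dotNl opprK.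
have -> : zh - z1 - (z - z1) = zh - z by rewrite opprB addrA subrK.
have := M_psd.2 (z - z1); rewrite !sqr_snorm // -/z1.
lra.
Qed.

Lemma iter_gap z zh k : orthant (usubmx zh) ->
  2 * \sum_(1 <= i < k.+1) saddle_gap (iter i step z) zh <=
  snorm M (zh - z) ^+ 2 - snorm M (zh - iter k step z) ^+ 2.
Proof.
move=> zh0; elim: k => [|k IH]; first by rewrite big_geq // mulr0 subrr.
rewrite big_nat_recr //= mulrDr.
by have := OnePDHG_gap (iter k step z) zh0; move: IH => /=; lra.
Qed.

Lemma avg_iterE z k (l : 'cV[R]_(n + m)) : (0 < k)%N ->
  k%:R * dot l (avg z k) = \sum_(1 <= i < k.+1) dot l (iter i step z).
Proof.
move=> k0; rewrite /avg_iter dotZr mulrA mulfV ?pnatr_eq0 -?lt0n // mul1r.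
elim: (index_iota _ _) => [|i s IH]; first by rewrite !big_nil dot0r.
by rewrite !big_cons dotDr IH.
Qed.

Lemma avg_gap z zh k : (0 < k)%N -> orthant (usubmx zh) ->
  2 * k%:R * saddle_gap (avg z k) zh <= snorm M (zh - z) ^+ 2.
Proof.
move=> k0 zh0; have := iter_gap z k zh0.
have -> : \sum_(1 <= i < k.+1) saddle_gap (iter i step z) zh =
    k%:R * saddle_gap (avg z k) zh.
  under eq_bigr do rewrite saddle_gap_affine.
  rewrite big_split /= -avg_iterE // saddle_gap_affine mulrDr; congr (_ + _).
  by rewrite big_const_nat iter_addr_0 subn1 mulr_natl.
by have := sqr_ge0 (snorm M (zh - iter k step z)); rewrite mulrA; lra.
Qed.

Lemma avg_ind (P : 'cV[R]_(n + m) -> Prop) z k :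
  (forall u v, P u -> P v -> P (u + v)) -> (forall a u, 0 <= a -> P u -> P (a *: u)) ->
  P 0 -> (forall i, (0 < i)%N -> P (iter i step z)) -> P (avg z k).
Proof.
move=> PD PZ P0 Pi; apply: PZ; first by rewrite invr_ge0.
rewrite big_nat_cond; apply: big_ind => // i /andP[/andP[i0 _] _].
exact: Pi.
Qed.

(** The condition y in Im A makes y recoverable, with a bound, from A^T y. Steps preserve it because
    b is in Im A. *)
Definition pdhg_inv (z : 'cV[R]_(n + m)) :=
  orthant (usubmx z) /\ exists v, dsubmx z = A *m v.

Hypothesis b_im : exists x : 'cV[R]_n, A *m x = b.

Lemma pdhg_inv0 : pdhg_inv 0.
Proof.
split; first by move=> i; rewrite linear0 mxE.
by exists 0; rewrite linear0 mulmx0.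
Qed.

Lemma pdhg_inv_step z : pdhg_inv z -> pdhg_inv (step z).
Proof.
move=> [_ [v vE]]; have [x0 x0E] := b_im.
rewrite /OnePDHG; set x1 := proj _ _.
split.
  by rewrite col_mxKu; case: (proj_orthantP (usubmx z - tau *: (c - A^T *m dsubmx z))).
exists (v + sigma *: (x0 - (2%:R *: x1 - usubmx z))).
by rewrite col_mxKd vE -x0E -mulmxBr scalemxAr -mulmxDr.
Qed.

Lemma pdhg_inv_iter z i : pdhg_inv z -> pdhg_inv (iter i step z).
Proof. by move=> z0; elim: i => //= i; exact: pdhg_inv_step. Qed.

Lemma pdhg_inv_avg z k : pdhg_inv z -> pdhg_inv (avg z k).
Proof.
move=> z0; apply: avg_ind => [u v [u0 [p pE]] [v0 [p' p'E]]|a u a0 [u0 [p pE]]||].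
- split; first by move=> i; rewrite linearD mxE addr_ge0.
  by exists (p + p'); rewrite mulmxDr linearD /= pE p'E.
- split; first by move=> i; rewrite linearZ mxE mulr_ge0.
  by exists (a *: p); rewrite -scalemxAr linearZ /= pE.
- exact: pdhg_inv0.
- by move=> i _; exact: pdhg_inv_iter.
Qed.

Definition saddle (zs : 'cV[R]_(n + m)) :=
  orthant (usubmx zs) /\
  forall z, orthant (usubmx z) -> 0 <= saddle_gap z zs.

(** Fejer monotonicity: the gap against a saddle point is nonnegative, so [OnePDHG_gap] makes the
    distance to it nonincreasing. *)
Lemma iter_dist z zs k : pdhg_inv z -> saddle zs ->
  snorm M (iter k step z - zs) <= snorm M (z - zs).
Proof.
move=> z0 [zs0 zsP]; elim: k => // k; apply: le_trans.
rewrite -(@ler_pXn2r _ 2) ?nnegrE ?snorm_ge0 //= !(snormC _ _ zs).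
have := OnePDHG_gap (iter k step z) zs0.
have [zk0 _] := pdhg_inv_step (pdhg_inv_iter k z0).
by have := zsP _ zk0; lra.
Qed.

Lemma avg_dist z zs k : (0 < k)%N -> pdhg_inv z -> saddle zs ->
  snorm M (avg z k - zs) <= snorm M (z - zs).
Proof.
move=> k0 z0 zsP.
have kR : (0 : R) < k%:R by rewrite ltr0n.
have -> : avg z k - zs = k%:R^-1 *: \sum_(1 <= i < k.+1) (iter i step z - zs).
  rewrite big_split /= scalerDr; congr (_ + _).
  rewrite big_const_nat iter_addr_0 subn1 /= -(scaler_nat k (- zs)) scalerA mulVf ?gt_eqF //.
  by rewrite scale1r.
rewrite snormZ ger0_norm ?invr_ge0 ?(ltW kR) // mulrC ler_pdivrMr //.
apply: le_trans (snorm_sum _ _ M_psd) _.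
apply: (@le_trans _ _ (\sum_(1 <= i < k.+1) snorm M (z - zs))).
  by apply: ler_sum => i _; exact: iter_dist.
by rewrite big_const_nat iter_addr_0 subn1 /= mulr_natr.
Qed.

Lemma avg_move z zs k : (0 < k)%N -> pdhg_inv z -> saddle zs ->
  snorm M (avg z k - z) <= 2 * snorm M (z - zs).
Proof.
move=> k0 z0 zsP; apply: le_trans (snormB_le _ zs _ M_psd) _.
by rewrite (snormC _ zs) mulrDl mul1r lerD2r avg_dist.
Qed.

(** A point within [r] of the average is within [2 * r] of the start, where the ergodic estimate
    applies. *)
Lemma avg_gap_ball z zh k r : (0 < k)%N -> orthant (usubmx zh) ->
  snorm M (avg z k - z) <= r -> snorm M (zh - avg z k) <= r ->
  saddle_gap (avg z k) zh <= r * (2 * r / k%:R).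
Proof.
move=> k0 zh0 zr zhr; have := avg_gap z k0 zh0.
have kR : (0 : R) < k%:R by rewrite ltr0n.
have : snorm M (zh - z) ^+ 2 <= (2 * r) ^+ 2.
  have r0 : 0 <= r by rewrite (le_trans _ zr) // snorm_ge0.
  rewrite ler_pXn2r ?nnegrE ?snorm_ge0 ?mulr_ge0 //.
  by apply: le_trans (snormB_le _ (avg z k) _ M_psd) _; lra.
rewrite mulrA ler_pdivlMr //; lra.
Qed.

Lemma ndg_ge0 r z : 0 <= r -> orthant (usubmx z) ->
  (0 <= ndg A b c tau sigma r z)%E.
Proof.
move=> r0 z0; apply: mule_ge0; first by rewrite lee_fin invr_ge0.
apply: ereal_sup_ubound; exists z.
  by split=> //; rewrite subrr -[Mnorm _ _ _ _]/(snorm M 0) snorm0.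
by rewrite subrr.
Qed.

Lemma ndg_le r B z : 0 <= r -> (0 < r -> forall zh, orthant (usubmx zh) ->
    snorm M (zh - z) <= r -> saddle_gap z zh <= r * B) ->
  0 <= B -> (ndg A b c tau sigma r z <= B%:E)%E.
Proof.
move=> r0 rB B0; have [rE|r_gt0] := eqVneq r 0.
  (* The factor 0 absorbs even an infinite supremum. *)
  by rewrite /ndg rE invr0 mul0e lee_fin.
have {}r0 : 0 < r by rewrite lt0r r_gt0.
have -> : B%:E = ((r^-1)%:E * (r * B)%:E)%E by rewrite -EFinM mulKf.
apply: lee_wpmul2l; first by rewrite lee_fin invr_ge0 ltW.
apply/ereal_supP => _ [zh [zh0 zhr] <-]; rewrite lee_fin; exact: rB.
Qed.

Lemma ndg_ge r B z zh : 0 < r -> (ndg A b c tau sigma r z <= B%:E)%E ->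
  orthant (usubmx zh) -> snorm M (zh - z) <= r -> saddle_gap z zh <= r * B.
Proof.
move=> r0 zB zh0 zhr; rewrite -lee_fin.
have -> : (r * B)%:E = (r%:E * B%:E)%E by [].
apply: le_trans (lee_wpmul2l _ zB); last by rewrite lee_fin ltW.
rewrite /ndg muleA -EFinM mulfV ?gt_eqF // mul1e.
by apply: ereal_sup_ubound; exists zh.
Qed.

Lemma ndg_avg z zs k : (0 < k)%N -> pdhg_inv z -> saddle zs ->
  (ndg A b c tau sigma (snorm M (avg z k - z)) (avg z k) <=
   (4 * snorm M (z - zs) / k%:R)%:E)%E.
Proof.
move=> k0 z0 zsP; have kR : (0 : R) < k%:R by rewrite ltr0n.
have zr := avg_move k0 z0 zsP.
apply: ndg_le; first exact: snorm_ge0.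
  move=> r0 zh zh0 zhr; apply: le_trans (avg_gap_ball k0 zh0 (lexx _) zhr) _.
  rewrite ler_wpM2l ?snorm_ge0 // ler_wpM2r ?invr_ge0 ?(ltW kR) //.
  by have := zr; lra.
by rewrite divr_ge0 ?mulr_ge0 ?snorm_ge0 // ltW.
Qed.

Hypothesis c_null : A *m c = 0.

Lemma saddle_opt x y : Wopt A b c (col_mx x (c - A^T *m y)) -> saddle (col_mx x y).
Proof.
move=> [[[Vx _] [x0 s0]] /= g0]; rewrite !(col_mxKu, col_mxKd) in Vx x0 s0.
split=> [|z z0]; first by rewrite col_mxKu.
rewrite saddle_gap_affine !(col_mxKu, col_mxKd) Vx subrr.
have := Gap_dual c_null b_im x y; rewrite g0 => g0'.
have -> : dot b y - dot c x = 0 by lra.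
by rewrite add0r -[z]vsubmxK dot_col_mx dot0l addr0 dot_nneg.
Qed.

End PDHG.

(** * Residuals for the canonical step sizes *)

Section StepSizes.
Variables (R : realType) (m n : nat) (A : 'M[R]_(m, n)).
Hypothesis A_neq0 : A != 0.

Local Notation lmin := (lambda_min A).
Local Notation lmax := (lambda_max A).
Local Notation tau0 := (kappa A)^-1.
Local Notation sigma0 := (lambda_max A * lambda_min A)^-1.
Local Notation M := (Mmx A tau0 sigma0).

Let lmin_gt0 : 0 < lmin. Proof. exact: lambda_min_gt0. Qed.
Let lmax_gt0 : 0 < lmax. Proof. exact: lambda_max_gt0. Qed.

Lemma kappa_gt0 : 0 < kappa A.
Proof. by rewrite divr_gt0. Qed.

Lemma kappa_ge1 : 1 <= kappa A.
Proof. by rewrite ler_pdivlMr // mul1r lambda_min_le_max. Qed.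

Lemma sqrt_lmaxmin : Num.sqrt (lmax * lmin) = lmin * Num.sqrt (kappa A).
Proof.
have -> : lmax * lmin = lmin ^+ 2 * kappa A by rewrite /kappa; field; rewrite gt_eqF.
by rewrite sqrtrM ?sqr_ge0 // sqrtr_sqr ger0_norm // ltW.
Qed.

Lemma MformE x y : dot (col_mx x y) (M *m col_mx x y) =
  kappa A * dot x x + 2 * dot (A *m x) y + lmax * lmin * dot y y.
Proof.
rewrite mul_block_col dot_col_mx !invrK !mul_scalar_mx !dotDr !dotZr.
by rewrite dot_mulmxr trmxK (dotC y (A *m x)); ring.
Qed.

(** Since [kappa A * lambda_max A * lambda_min A] equals lambda_max^2, the right side exceeds 2
    lambda_max |x| |y| by exactly a square. *)
Let cross_le (x : 'cV[R]_n) (y : 'cV[R]_m) :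
  2 * `|dot (A *m x) y| <= kappa A * dot x x + lmax * lmin * dot y y.
Proof.
have Axy : `|dot (A *m x) y| <= lmax * enorm x * enorm y.
  rewrite ler_norml lerNl -dotNr.
  have H v : dot (A *m x) v <= lmax * enorm x * enorm v.
    apply: le_trans (enorm_CauchySchwarz _ _) _.
    by rewrite ler_wpM2r ?enorm_ge0 // lambda_maxP.
  by rewrite -{1}(enormN y) !H.
rewrite -!sqr_enorm.
have -> : kappa A * enorm x ^+ 2 + lmax * lmin * enorm y ^+ 2 =
   2 * (lmax * enorm x * enorm y) + kappa A * (enorm x - lmin * enorm y) ^+ 2.
  by rewrite /kappa; field; rewrite gt_eqF.
rewrite -[leLHS]addr0 lerD ?ler_pM2l // mulr_ge0 ?sqr_ge0 // ltW //.
exact: kappa_gt0.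
Qed.

Lemma M_psd : psd M.
Proof.
split; first by rewrite tr_block_mx !tr_scalar_mx trmxK.
move=> z; rewrite -[z]vsubmxK MformE.
have := cross_le (usubmx z) (dsubmx z).
have := ler_norm (- dot (A *m usubmx z) (dsubmx z)); rewrite normrN; lra.
Qed.

Lemma snorm_primal x : snorm M (col_mx x 0) = Num.sqrt (kappa A) * enorm x.
Proof. by rewrite /snorm MformE !dot0r !mulr0 !addr0 sqrtrM ?(ltW kappa_gt0). Qed.

Lemma snorm_dual y : snorm M (col_mx 0 y) = lmin * Num.sqrt (kappa A) * enorm y.
Proof.
rewrite -sqrt_lmaxmin /snorm MformE mulmx0 !dot0l !mulr0 !add0r sqrtrM //.
by rewrite mulr_ge0 ?(ltW lmin_gt0) ?(ltW lmax_gt0).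
Qed.

(** The cross term at most doubles the diagonal, whence the factor 2; on Im A the dual diagonal term
    is at most kappa |A^T y|^2. *)
Lemma snorm_le_enorm x v : snorm M (col_mx x (A *m v)) <=
  Num.sqrt (2 * kappa A) * enorm (col_mx x (A^T *m (A *m v))).
Proof.
have k0 := kappa_gt0.
set y := A *m v; have yl : lmin * enorm y <= enorm (A^T *m y) by exact: lambda_min_trmx.
rewrite -(@ler_pXn2r _ 2) ?nnegrE ?mulr_ge0 ?snorm_ge0 ?enorm_ge0 ?sqrtr_ge0 //.
have sk : Num.sqrt (2 * kappa A) ^+ 2 = 2 * kappa A.
  by rewrite sqr_sqrtr // mulr_ge0 // ltW.
rewrite (sqr_snorm _ M_psd) exprMn sk MformE enorm_col_mx.
have := cross_le x y; have := ler_norm (dot (A *m x) y).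
rewrite -!sqr_enorm.
have : lmax * lmin * enorm y ^+ 2 <= kappa A * enorm (A^T *m y) ^+ 2.
  have -> : lmax * lmin * enorm y ^+ 2 = kappa A * (lmin * enorm y) ^+ 2.
    by rewrite /kappa; field; rewrite gt_eqF.
  rewrite ler_pM2l // ler_pXn2r ?nnegrE ?mulr_ge0 ?enorm_ge0 // ltW //.
lra.
Qed.

(** * From the normalized duality gap to infeasibility and gap *)

Section Residuals.
Variables (b : 'cV[R]_m) (c : 'cV[R]_n).
Hypothesis c_null : A *m c = 0.
Hypothesis b_im : exists x : 'cV[R]_n, A *m x = b.

Local Notation gap := (Gap A b c).

Definition neg_part (s : 'cV[R]_n) : 'cV[R]_n := \col_i Num.max 0 (- s i 0).

Lemma neg_part_ge0 s : orthant (neg_part s).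
Proof. by move=> i; rewrite mxE le_max lexx. Qed.

Lemma dot_neg_part s : dot s (neg_part s) = - enorm (neg_part s) ^+ 2.
Proof.
rewrite sqr_enorm -dotNl; apply: eq_bigr => i _; rewrite !mxE.
by case: (leP 0 (- s i 0)); rewrite ?mulr0 ?mul0r ?opprK.
Qed.

Lemma dist_le d (w v : 'cV[R]_d) S : S v -> dist w S <= enorm (w - v).
Proof.
move=> Sv; apply: ge_inf; last by exists v.
by exists 0 => _ [u _ <-]; exact: enorm_ge0.
Qed.

(** Adding to x the vector of Im(A^T) that cancels the primal residual gives a point of [V]. As [c]
    is orthogonal to Im(A^T), the gap is unchanged. The dual part is already in [Vd], so only its
    negative part counts. *)
Lemma residual_errors x y e : orthant x -> 0 <= e ->
  enorm (b - A *m x) <= lmin * e -> enorm (neg_part (c - A^T *m y)) <= e ->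
  let w := col_mx x (c - A^T *m y) in
  Econs A b c w <= e /\
  exists w', [/\ Vpd A b c w', enorm (w - w') <= e, forall i, - e <= w' i 0 &
    gap w' = gap w].
Proof.
move=> x0 e0 rp rd w; set s := c - A^T *m y in rd w *.
pose v := mp_inverse (A *m A^T) *m (b - A *m x).
pose x' := x + A^T *m v.
have Ax' : A *m x' = b.
  rewrite /x' /v mulmxDr; have [x1 <-] := b_im.
  rewrite -(mulmxBr A) !mulmxA mulmx_gram_mpK.
  by rewrite -mulmxDr addrC subrK.
have x'x : enorm (x - x') <= e.
  have -> : x - x' = - (A^T *m v) by rewrite opprD addrA subrr sub0r.
  rewrite enormN -(ler_pM2l lmin_gt0) (le_trans _ rp) //.
  have -> : b - A *m x = A *m (A^T *m v).
    by rewrite -Ax' mulmxDr addrAC subrr add0r.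
  by apply: (lambda_minP A_neq0).2; rewrite mulmxA rowproj_trmx.
have Vw' : Vpd A b c (col_mx x' s).
  split; rewrite /Vp /Vd /= ?col_mxKu ?col_mxKd //.
  by exists (- y); rewrite ?mulmxN.
have ww' : enorm (w - col_mx x' s) <= e.
  rewrite /w opp_col_mx add_col_mx subrr (le_trans (enorm_col_mx_le _ _)) //.
  by rewrite enorm0 addr0.
have dK : dist w (@Kpd R n) <= e.
  have Kw : @Kpd R n (col_mx x (s + neg_part s)).
    split; rewrite ?col_mxKu ?col_mxKd // => i.
    have : - s i 0 <= neg_part s i 0 by rewrite [neg_part s i 0]mxE le_max lexx orbT.
    by rewrite [(s + _) i 0]mxE; lra.
  apply: le_trans (dist_le _ Kw) _.
  rewrite /w opp_col_mx add_col_mx subrr opprD addrA subrr sub0r.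
  by rewrite (le_trans (enorm_col_mx_le _ _)) // enorm0 add0r enormN.
split.
  by rewrite /Econs ge_max dK andbT (le_trans (dist_le _ Vw')).
exists (col_mx x' s); split => // [i|].
  case: (split_ordP i) => j ->; rewrite ?col_mxEu ?col_mxEd.
    have := le_trans (coord_le_enorm (x - x') j) x'x.
    by rewrite !mxE ler_norml => /andP[_]; have := x0 j; lra.
  have := le_trans (coord_le_enorm (neg_part s) j) rd.
  rewrite mxE ger0_norm ?le_max ?lexx // ge_max => /andP[_]; lra.
rewrite /w !Gap_dual // /x' dotDr dot_mulmxr trmxK c_null dot0l addr0 //.
Qed.

(** One test point per error: y moved along the primal residual, x moved along the negative part of
    s, and z shrunk towards 0. The first two are scaled to M-distance exactly [r]. *)
Lemma gap_ball_errors z r rho : 0 < r -> 0 <= rho -> orthant (usubmx z) ->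
  (forall zh, orthant (usubmx zh) -> snorm M (zh - z) <= r ->
    saddle_gap A b c z zh <= r * rho) ->
  [/\ enorm (b - A *m usubmx z) <= lmin * (Num.sqrt (kappa A) * rho),
      enorm (neg_part (c - A^T *m dsubmx z)) <= Num.sqrt (kappa A) * rho &
      gap (wof A c z) <= Num.max r (snorm M z) * rho].
Proof.
move=> r0 rho0; rewrite -[z]vsubmxK; move: (usubmx z) (dsubmx z) => x y.
rewrite /wof !col_mxKu !col_mxKd => x0 H.
have k0 : 0 < Num.sqrt (kappa A) by rewrite sqrtr_gt0 kappa_gt0.
have gE xh yh : saddle_gap A b c (col_mx x y) (col_mx xh yh) =
  dot (b - A *m x) (yh - y) - dot (c - A^T *m y) (xh - x).
  by rewrite saddle_gapE !col_mxKu !col_mxKd.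
split.
- set p := b - A *m x; have [->|p0] := eqVneq p 0.
    by rewrite enorm0 !mulr_ge0 // ltW.
  have p_gt0 : 0 < enorm p by rewrite enorm_gt0.
  pose N := lmin * Num.sqrt (kappa A) * enorm p.
  have N0 : 0 < N by rewrite !mulr_gt0.
  have := H (col_mx x (y + (r / N) *: p)).
  rewrite gE col_mxKu opp_col_mx add_col_mx subrr addrAC subrr add0r dot0r subr0.
  rewrite snorm_dual enormZ ger0_norm ?divr_ge0 ?(ltW r0) ?(ltW N0) //.
  rewrite -/p dotZr -sqr_enorm.
  have -> : lmin * Num.sqrt (kappa A) * (r / N * enorm p) = r.
    by rewrite /N; field; rewrite !gt_eqF.
  have -> : r / N * enorm p ^+ 2 = r * (enorm p / (lmin * Num.sqrt (kappa A))).
    by rewrite /N; field; rewrite !gt_eqF.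
  move=> /(_ x0 (lexx _)); rewrite ler_pM2l // ler_pdivrMr ?mulr_gt0 //.
  by rewrite mulrC mulrA.
- set s := c - A^T *m y; set p := neg_part s; have [->|p0] := eqVneq p 0.
    by rewrite enorm0 !mulr_ge0 // ltW.
  have p_gt0 : 0 < enorm p by rewrite enorm_gt0.
  pose N := Num.sqrt (kappa A) * enorm p.
  have N0 : 0 < N by rewrite !mulr_gt0.
  have := H (col_mx (x + (r / N) *: p) y).
  rewrite gE col_mxKu opp_col_mx add_col_mx subrr addrAC subrr add0r dot0r sub0r.
  rewrite snorm_primal enormZ ger0_norm ?divr_ge0 ?(ltW r0) ?(ltW N0) //.
  rewrite -/s dotZr dot_neg_part mulrN opprK -/p.
  have -> : Num.sqrt (kappa A) * (r / N * enorm p) = r.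
    by rewrite /N; field; rewrite !gt_eqF.
  have -> : r / N * enorm p ^+ 2 = r * (enorm p / Num.sqrt (kappa A)).
    by rewrite /N; field; rewrite !gt_eqF.
  have xp : orthant (x + (r / N) *: p).
    move=> i; rewrite !mxE addr_ge0 // mulr_ge0 ?le_max ?lexx //.
    by rewrite divr_ge0 ?(ltW r0) ?(ltW N0).
  move=> /(_ xp (lexx _)); rewrite ler_pM2l // ler_pdivrMr //.
  by rewrite mulrC.
- have scale t : 0 <= t <= 1 -> t * snorm M (col_mx x y) <= r ->
      t * gap (col_mx x (c - A^T *m y)) <= r * rho.
    move=> /andP[t0 t1] tz.
    have := H (col_mx (x - t *: x) (y - t *: y)).
    rewrite gE col_mxKu opp_col_mx add_col_mx addrAC subrr sub0r.
    rewrite addrAC subrr sub0r -!scaleNr -scale_col_mx snormZ normrN ger0_norm //.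
    have -> : dot (b - A *m x) (- t *: y) - dot (c - A^T *m y) (- t *: x) =
        t * gap (col_mx x (c - A^T *m y)).
      rewrite Gap_dual // !dotZr !dotBl dot_mulmxl (dotC (A^T *m y)); ring.
    apply=> // i; rewrite !mxE.
    by have := x0 i; nra.
  have [zr|zr] := leP (snorm M (col_mx x y)) r.
    by have := scale 1; rewrite !mul1r ler01 lexx; apply.
  have z0 : 0 < snorm M (col_mx x y) by exact: lt_trans zr.
  have := scale (r / snorm M (col_mx x y)).
  rewrite divfK ?gt_eqF // lexx ler_pdivrMr // mul1r (ltW zr).
  rewrite divr_ge0 ?(ltW r0) ?(ltW z0) // => /(_ isT isT).
  by rewrite mulrAC -mulrA ler_pM2l // ler_pdivrMr // mulrC.
Qed.

End Residuals.
End StepSizes.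

(** * Strong duality *)

Section StrongDuality.
Variables (R : realType) (m n : nat) (A : 'M[R]_(m, n)).
Variables (b : 'cV[R]_m) (c : 'cV[R]_n).
Hypothesis A_neq0 : A != 0.
Hypothesis c_null : A *m c = 0.
Variables (wr : 'cV[R]_(n + n)) (r : R).
Hypothesis r_gt0 : 0 < r.
Hypothesis Fwr : feasible A b c wr.
Hypothesis wr_ge : forall i, r <= wr i 0.

Local Notation F := (feasible A b c).
Local Notation gap := (Gap A b c).
Local Notation tau0 := (kappa A)^-1.
Local Notation sigma0 := (lambda_max A * lambda_min A)^-1.
Local Notation M := (Mmx A tau0 sigma0).
Local Notation avg := (avg_iter A b c tau0 sigma0).

Lemma feasible_im : exists x : 'cV[R]_n, A *m x = b.
Proof. by case: Fwr => [[wrx _] _]; exists (usubmx wr). Qed.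

Let b_im := feasible_im.
Let k0 : 0 < kappa A. Proof. exact: kappa_gt0. Qed.
Let l0 : 0 < lambda_min A. Proof. exact: lambda_min_gt0. Qed.
Let L0 : 0 < lambda_max A. Proof. exact: lambda_max_gt0. Qed.
Let tau_gt0 : 0 < tau0. Proof. by rewrite invr_gt0. Qed.
Let sigma_gt0 : 0 < sigma0. Proof. by rewrite invr_gt0 mulr_gt0. Qed.

Lemma Gap_as_saddle_gap z : gap (wof A c z) = saddle_gap A b c z 0.
Proof.
rewrite /wof Gap_dual // saddle_gapE !linear0 !sub0r !dotNr opprK dotBl.
by rewrite dot_mulmxl dotBl dot_mulmxl trmxK (dotC (dsubmx z)) dot_mulmxl; ring.
Qed.

(* Testing the average from 0 against [(2 x, y)] and [(x, 2 y)], for the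
   strictly feasible point given by [(x, y)], bounds its gap from below. *)
Lemma avg0_gap_bounded : exists C : R, forall k, (0 < k)%N ->
  gap (wof A c (avg 0 k)) <= 0 /\ - C <= gap (wof A c (avg 0 k)).
Proof.
have [[wrx [yr _ ysE]] Kwr] := Fwr.
pose xs := usubmx wr; pose ys := - yr; pose ss := dsubmx wr.
have ssE : c - A^T *m ys = ss by rewrite /ys mulmxN opprK.
have xs0 : orthant xs by case: Kwr.
have ss0 : orthant ss by case: Kwr.
pose zh1 := col_mx (2 *: xs) ys; pose zh2 := col_mx xs (2 *: ys).
pose Q1 := snorm M zh1 ^+ 2; pose Q2 := snorm M zh2 ^+ 2.
exists (Q1 + Q2 + 3 * dot c xs - 3 * dot b ys) => k kpos.
have [x0 _] : pdhg_inv A (avg 0 k) by apply: pdhg_inv_avg => //; exact: pdhg_inv0.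
have kR : (1 : R) <= k%:R by rewrite ler1n.
have H zh : orthant (usubmx zh) ->
    saddle_gap A b c (avg 0 k) zh <= snorm M zh ^+ 2 / (2 * k%:R).
  move=> zh0; rewrite ler_pdivlMr; last by lra.
  have := avg_gap b c tau_gt0 sigma_gt0 (M_psd A_neq0) 0 kpos zh0.
  by rewrite subr0 mulrC.
have H' zh : orthant (usubmx zh) ->
    saddle_gap A b c (avg 0 k) zh <= snorm M zh ^+ 2.
  move=> /H h; apply: le_trans h _; rewrite ler_pdivrMr; last by lra.
  by have := sqr_ge0 (snorm M zh); nra.
split.
  rewrite Gap_as_saddle_gap (le_trans (H _ _)) // => [i|].
    by rewrite linear0 mxE.
  by rewrite snorm0 expr0n mul0r.
have h1 : saddle_gap A b c (avg 0 k) zh1 <= Q1.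
  by apply: H'; rewrite col_mxKu => i; rewrite mxE mulr_ge0.
have h2 : saddle_gap A b c (avg 0 k) zh2 <= Q2 by apply: H'; rewrite col_mxKu.
move: h1 h2 x0; rewrite /wof Gap_dual //; move: (avg 0 k) => z.
rewrite -[z]vsubmxK !col_mxKu !col_mxKd; move: (usubmx z) (dsubmx z) => x y h1 h2 x0.
move: h1 h2; rewrite !saddle_gap_affine !col_mxKu !col_mxKd !dot_col_mx -!scalemxAr ssE.
have -> : A *m xs = b by [].
have -> : c - 2 *: (A^T *m ys) = 2 *: ss - c.
  by rewrite -ssE; apply/colP => i; rewrite !mxE; ring.
have -> : 2 *: b - b = b by rewrite scaler_nat mulr2n addrK.
(* The sum of the two inequalities bounds 3 <ss, x> - gap from above, and <ss, x> is nonnegative. *)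
rewrite subrr !dot_lin => h1 h2.
by have := dot_nneg ss0 x0; lra.
Qed.

(** Testing against [t] times the residual vector adds [t * E] to the gap at a quadratic cost. With
    [t = k / B] that cost absorbs only half of the gain, so [t * E <= - 2 * gap], which is
    bounded. *)
Lemma avg0_residual : exists C : R, 0 <= C /\ forall k, (0 < k)%N ->
  let z := avg 0 k in
  gap (wof A c z) <= 0 /\
  enorm (b - A *m usubmx z) ^+ 2 +
    enorm (neg_part (c - A^T *m dsubmx z)) ^+ 2 <= C / k%:R.
Proof.
have [C0 HC0] := avg0_gap_bounded.
pose B := 2 * (kappa A + lambda_max A * lambda_min A).
have B0 : 0 < B by rewrite mulr_gt0 // addr_gt0 // mulr_gt0.
have C0' : 0 <= C0 by have [? ?] := HC0 1%N isT; lra.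
exists (2 * C0 * B); split; first by rewrite mulr_ge0 ?(ltW B0) //; lra.
move=> k kpos z; have [gz0 gz] := HC0 k kpos; split=> //.
have kR : (0 : R) < k%:R by rewrite ltr0n.
set p := b - A *m usubmx z; set d := neg_part _; set E := _ + _.
have E0 : 0 <= E by rewrite addr_ge0 ?sqr_ge0.
pose t := k%:R / B; have t0 : 0 < t by rewrite divr_gt0.
pose zh := t *: col_mx d p.
have zhE : zh = col_mx (t *: d) (t *: p) by rewrite -scale_col_mx.
have zh0 : orthant (usubmx zh).
  by rewrite zhE col_mxKu => i; rewrite mxE mulr_ge0 ?(ltW t0) ?neg_part_ge0.
have := avg_gap b c tau_gt0 sigma_gt0 (M_psd A_neq0) 0 kpos zh0.
rewrite subr0 -/z.
have -> : saddle_gap A b c z zh = gap (wof A c z) + t * E.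
  rewrite Gap_as_saddle_gap !saddle_gapE zhE col_mxKu col_mxKd !linear0 !sub0r.
  rewrite -/p !dotBr !dotNr !dotZr dot_neg_part -/d -(sqr_enorm p) /E; ring.
have : snorm M zh ^+ 2 <= t ^+ 2 * (B * E).
  rewrite snormZ exprMn real_normK ?num_real // ler_pM2l ?exprn_gt0 //.
  have dB : snorm M (col_mx d p) <= snorm M (col_mx d 0) + snorm M (col_mx 0 p).
    apply: le_trans (snormD _ _ (M_psd A_neq0)).
    by rewrite add_col_mx addr0 add0r.
  have : snorm M (col_mx d p) ^+ 2 <=
      2 * (snorm M (col_mx d 0) ^+ 2 + snorm M (col_mx 0 p) ^+ 2).
    move: dB; have := snorm_ge0 M (col_mx d p).
    move: (snorm M (col_mx d p)) (snorm M (col_mx d 0)) (snorm M (col_mx 0 p)).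
    move=> a u v a0 auv.
    have := sqr_ge0 (u - v); have : a ^+ 2 <= (u + v) ^+ 2.
      by have uv0 := le_trans a0 auv; rewrite ler_pXn2r.
    lra.
  move=> h; apply: le_trans h _.
  have Ll0 := mulr_gt0 L0 l0.
  rewrite snorm_primal // snorm_dual // -sqrt_lmaxmin // !exprMn.
  rewrite (sqr_sqrtr (ltW k0)) (sqr_sqrtr (ltW Ll0)) /B /E.
  have := mulr_ge0 (ltW Ll0) (sqr_ge0 (enorm d)).
  by have := mulr_ge0 (ltW k0) (sqr_ge0 (enorm p)); lra.
have -> : t ^+ 2 * (B * E) = k%:R * t * E by rewrite /t; field; rewrite gt_eqF.
rewrite ler_pdivlMr // => h1 h2.
have h3 : 2 * k%:R * (gap (wof A c z) + t * E) <= k%:R * t * E by exact: le_trans h2 h1.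
have h4 : k%:R * (2 * gap (wof A c z) + t * E) <= 0 by lra.
rewrite pmulr_rle0 // in h4.
have -> : E * k%:R = B * (t * E) by rewrite /t; field; rewrite gt_eqF.
by rewrite [leRHS]mulrC ler_pM2l //; lra.
Qed.

Lemma gap_arbitrarily_small eta : 0 < eta -> exists2 w, F w & gap w <= eta.
Proof.
move=> eta0; have [C [C0 HC]] := avg0_residual.
have gwr0 := Gap_ge0 c_null b_im Fwr.
(* Chosen so that the weight [a = e / r] given to [wr] contributes at most [eta] to the gap. *)
pose e := eta * r / (gap wr + 1).
have g1 : 0 < gap wr + 1 by lra.
have e0 : 0 < e by rewrite divr_gt0 ?mulr_gt0.
pose B := Num.min 1 (lambda_min A) * e.
have lm : 0 < Num.min 1 (lambda_min A) by rewrite lt_min ltr01.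
have B0 : 0 < B by rewrite mulr_gt0.
pose k := (Num.truncn (C / B ^+ 2)).+1.
have [gz res] := HC k isT; set z := avg 0 k in gz res.
have kC : C / k%:R <= B ^+ 2.
  rewrite ler_pdivrMr ?ltr0n // mulrC -ler_pdivrMr ?exprn_gt0 //.
  by rewrite ltW // truncnS_gt.
have sq a : 0 <= a -> a ^+ 2 <= B ^+ 2 -> a <= B.
  by move=> a0; rewrite ler_pXn2r // nnegrE // ltW.
have rp : enorm (b - A *m usubmx z) <= B.
  apply: sq; first exact: enorm_ge0.
  by have := sqr_ge0 (enorm (neg_part (c - A^T *m dsubmx z))); lra.
have rd : enorm (neg_part (c - A^T *m dsubmx z)) <= B.
  apply: sq; first exact: enorm_ge0.
  by have := sqr_ge0 (enorm (b - A *m usubmx z)); lra.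
have [x0 _] : pdhg_inv A z by apply: pdhg_inv_avg => //; exact: pdhg_inv0.
have Ble : B <= lambda_min A * e by rewrite ler_pM2r // ge_min lexx orbT.
have Be : B <= e by rewrite -[leRHS]mul1r ler_pM2r // ge_min lexx.
have [_ [w' [Vw' _ w'e gw']]] := residual_errors A_neq0 c_null b_im x0 (ltW e0)
  (le_trans rp Ble) (le_trans rd Be).
pose a := e / r; have a0 : 0 < a by rewrite divr_gt0.
pose t := (1 + a)^-1.
exists (t *: w' + (1 - t) *: wr).
  split; first by apply: Vpd_comb => //; case: Fwr.
  apply/Kpd_orthant => i; rewrite !mxE.
  have -> : t * w' i 0 + (1 - t) * wr i 0 = (w' i 0 + a * wr i 0) / (1 + a).
    by rewrite /t; field; rewrite gt_eqF // addr_gt0.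
  rewrite divr_ge0 //; last by lra.
  have : a * r <= a * wr i 0 by rewrite ler_pM2l.
  have -> : a * r = e by rewrite divfK // gt_eqF.
  by have := w'e i; lra.
rewrite Gap_comb gw'.
have -> : 1 - t = a * t by rewrite /t; field; rewrite gt_eqF // addr_gt0.
have t0 : 0 < t by rewrite invr_gt0 addr_gt0.
have t1 : t <= 1 by rewrite invf_le1; lra.
have ag : a * gap wr <= eta.
  have -> : a * gap wr = eta * (gap wr / (gap wr + 1)).
    by rewrite /a /e; field; rewrite !gt_eqF.
  by rewrite ler_piMr ?(ltW eta0) // ler_pdivrMr //; lra.
have h1 : t * gap (wof A c z) <= 0 by rewrite pmulr_rle0.
have h2 : t * (a * gap wr) <= eta.
  by rewrite (le_trans _ ag) // ler_piMl // mulr_ge0 // ltW.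
rewrite /wof in h1; lra.
Qed.

(** [Vd] is an image; since the projector annihilates [c], it is also the solution set of the linear
    equation (1 - P) s = c, which is visibly closed. *)
Lemma closed_Wlevel delta : closed (Wlevel A b c delta).
Proof.
have Pc : rowproj A *m c = 0 by rewrite /rowproj -mulmxA c_null mulmx0.
have -> : Wlevel A b c delta =
    [set w | row_mx A 0 *m w = b] `&`
    [set w | row_mx 0 (1%:M - rowproj A) *m w = c] `&`
    [set w | orthant (1%:M *m w)] `&` [set w | dot (col_mx c (qvec A b)) w <= delta].
  apply/seteqP; split=> w /=.
    move=> [[[wx [y _ wy]] /Kpd_orthant w0] /=]; rewrite GapE => gw.
    split=> //; split; last by rewrite mul1mx.
    split; rewrite -[w]vsubmxK mul_row_col mul0mx ?addr0 ?add0r //.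
    rewrite -wy mulmxDr !mulmxBl !mul1mx Pc subr0 mulmxA rowproj_trmx subrr.
    by rewrite addr0.
  move=> [[[wx ws] w0] gw]; split; last by rewrite /= GapE.
  rewrite mul1mx in w0; split; last exact/Kpd_orthant.
  rewrite -[w]vsubmxK mul_row_col mul0mx addr0 in wx.
  rewrite -[w]vsubmxK mul_row_col mul0mx add0r in ws.
  split=> //; exists (mp_inverse (A *m A^T) *m A *m dsubmx w) => //.
  by rewrite -ws mulmxBl mul1mx -/(rowproj A) /rowproj !mulmxA subrK.
apply: closedI; last by apply: closed_fun_le; exact: continuous_dotl.
apply: closedI; last exact: closed_mulmx_nneg.
by apply: closedI; exact: closed_mulmx_eq.
Qed.

(** Level sets are compact, being bounded through [enorm_le_Gap], so the gap attains its minimum; by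
    [gap_arbitrarily_small] that minimum is 0. *)
Lemma Wopt_exists : exists w, Wopt A b c w.
Proof.
have S0 : Wlevel A b c 1 !=set0.
  by have [w Fw gw] := gap_arbitrarily_small ltr01; exists w.
have SB u : Wlevel A b c 1 u -> forall i, `|u i 0| <= (1 + gap wr) / r.
  move=> [Fu /= gu] i; apply: le_trans (coord_le_enorm _ _) _.
  rewrite ler_pdivlMr // mulrC.
  by apply: le_trans (enorm_le_Gap c_null b_im r_gt0 Fu Fwr wr_ge) _; rewrite lerD2r.
have cf : continuous gap.
  rewrite (_ : gap = dot (col_mx c (qvec A b))); first exact: continuous_dotl.
  by apply/funext => w; rewrite GapE.
have [u [Fu gu] umin] := closed_bounded_min S0 (@closed_Wlevel 1) SB cf.
exists u; split=> //=; apply/eqP; rewrite eq_le Gap_ge0 // andbT.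
apply/ler_addgt0Pr => eta eta0; rewrite add0r.
have m0 : 0 < Num.min 1 eta by rewrite lt_min ltr01.
have [w Fw] := gap_arbitrarily_small m0; rewrite le_min => /andP[w1 we].
exact: le_trans (umin w (conj Fw w1)) we.
Qed.

End StrongDuality.

(** * Convergence of the restarted method *)

Lemma expR1_le3 (R : realType) : expR (1 : R) <= 3.
Proof.
(* From 1 + x <= e^x at x = -1/8, raised to the power 8, using 3 (7/8)^8 >= 1. *)
have h : 7 / 8 <= expR (- 8^-1 : R) by have := expR_ge1Dx (- 8^-1 : R); lra.
have : (7 / 8) ^+ 8 <= expR (- 1 : R).
  have -> : (- 1 : R) = 8%:R * - 8^-1 by field.
  by rewrite expRM_natl ler_pXn2r // nnegrE ?expR_ge0 //; lra.
rewrite expRN => h8; have e0 := expR_gt0 (1 : R).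
rewrite -(ler_pM2r (_ : 0 < (expR 1)^-1)) ?invr_gt0 // mulfV ?gt_eqF //.
have : (3 : R) * (7 / 8) ^+ 8 >= 1 by rewrite !exprS expr0; lra.
lra.
Qed.

Lemma sqrt2_bounds (R : realType) :
  (0 : R) < Num.sqrt 2%:R /\ Num.sqrt (2%:R : R) <= 283 / 200.
Proof.
split; first by rewrite sqrtr_gt0 ltr0n.
rewrite -(@ler_pXn2r _ 2) ?nnegrE ?sqrtr_ge0 //.
by rewrite sqr_sqrtr ?ler0n // expr2; lra.
Qed.

Lemma ncols_gt0 (R : realType) m n (A : 'M[R]_(m, n)) : A != 0 -> (0 < n)%N.
Proof. by case: n A => // A /eqP[]; apply/matrixP => i []. Qed.

Section Restarts.
Variables (R : realType) (m n : nat) (A : 'M[R]_(m, n)).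
Variables (b : 'cV[R]_m) (c : 'cV[R]_n).
Hypothesis A_neq0 : A != 0.
Hypothesis c_null : A *m c = 0.
Hypothesis b_im : exists x : 'cV[R]_n, A *m x = b.

Local Notation F := (feasible A b c).
Local Notation gap := (Gap A b c).
Local Notation tau0 := (kappa A)^-1.
Local Notation sigma0 := (lambda_max A * lambda_min A)^-1.
Local Notation beta := (expR (1 : R))^-1.
Local Notation M := (Mmx A tau0 sigma0).
Local Notation avg := (avg_iter A b c tau0 sigma0).
Local Notation rho := (ndg A b c tau0 sigma0).
Local Notation runs := (rPDHG_run A b c tau0 sigma0 beta 0).
Local Notation restart := (restart_at A b c tau0 sigma0 beta).
Local Notation length := (restart_length A b c tau0 sigma0 beta).

Let k0 : 0 < kappa A. Proof. exact: kappa_gt0. Qed.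
Let sk0 : 0 < Num.sqrt (kappa A). Proof. by rewrite sqrtr_gt0. Qed.
Let l0 : 0 < lambda_min A. Proof. exact: lambda_min_gt0. Qed.
Let L0 : 0 < lambda_max A. Proof. exact: lambda_max_gt0. Qed.
Let tau_gt0 : 0 < tau0. Proof. by rewrite invr_gt0. Qed.
Let sigma_gt0 : 0 < sigma0. Proof. by rewrite invr_gt0 mulr_gt0. Qed.
Let Mpsd : psd M. Proof. exact: M_psd. Qed.

(** Any multiplier can be replaced by its projection onto Im A without changing the dual slack. *)
Lemma trmx_im_proj (y : 'cV[R]_m) :
  exists v, A^T *m (A *m v) = A^T *m y.
Proof.
have [_ _ GBsym _] := mp_inverseP (A *m A^T).
exists (A^T *m (mp_inverse (A *m A^T) *m y)).
have /(congr1 trmx) := mulmx_gram_mpK A.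
by rewrite trmx_mul GBsym !mulmxA => ->.
Qed.

(** Choosing the optimal multiplier in Im A puts the dual difference in Im A as well, so that
    [snorm_le_enorm] applies. *)
Lemma saddle_near z ws : pdhg_inv A z -> Wopt A b c ws ->
  exists2 zs, saddle A b c zs &
    snorm M (z - zs) <= Num.sqrt (2 * kappa A) * enorm (wof A c z - ws).
Proof.
move=> [_ [vz vzE]] opt; have [[[_ [y0 _ y0E]] _] _] := opt.
have [v vE] := trmx_im_proj y0.
pose ys := A *m - v.
have ysE : c - A^T *m ys = dsubmx ws by rewrite /ys !mulmxN opprK vE.
have optz : Wopt A b c (col_mx (usubmx ws) (c - A^T *m ys)) by rewrite ysE vsubmxK.
exists (col_mx (usubmx ws) ys); first exact: saddle_opt optz.
have -> : z - col_mx (usubmx ws) ys = col_mx (usubmx z - usubmx ws) (A *m (vz + v)).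
  rewrite -{1}[z]vsubmxK vzE opp_col_mx add_col_mx; congr (col_mx _ _).
  by rewrite /ys mulmxN opprK mulmxDr.
apply: le_trans (snorm_le_enorm A_neq0 _ _) _; rewrite ler_wpM2l ?sqrtr_ge0 //.
rewrite le_eqVlt; apply/orP; left; apply/eqP.
rewrite -[in RHS](vsubmxK ws) /wof opp_col_mx add_col_mx -ysE.
have -> : c - A^T *m dsubmx z - (c - A^T *m ys) = - (A^T *m (A *m (vz + v))).
  rewrite vzE /ys !mulmxDr !mulmxN; apply/colP => i; rewrite !mxE; ring.
by rewrite /enorm !dot_col_mx dotNl dotNr opprK.
Qed.

(** The starting point is w = (0, c), and the dual part of a point of [V] differs from [c] by a
    vector orthogonal to [c]. *)
Lemma wof0_near w : Vpd A b c w -> enorm (wof A c 0 - w) <= enorm w.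
Proof.
move=> [_ [y _ yE]]; rewrite -[w]vsubmxK /wof opp_col_mx add_col_mx.
rewrite !linear0 addr0 add0r -yE opprD addrA subrr add0r.
rewrite ler_wsqrtr // !dot_col_mx !dot_lin (dotC c (A^T *m y)).
by rewrite (dot_trmx_null c_null); have := dot_ge0 c; lra.
Qed.

Lemma Econs0_le w : F w -> Econs A b c (wof A c 0) <= enorm w.
Proof.
move=> [Vw Kw]; rewrite ge_max.
by rewrite !(le_trans (dist_le _ _) (wof0_near Vw)).
Qed.

Lemma Gap_wof0 : gap (wof A c 0) = 0.
Proof. by rewrite /wof Gap_dual // !linear0 !dot0r subrr. Qed.

(** * Error decay along a run *)

Section Convergence.
Variables (eps_cons eps_gap : R).
Hypothesis eps_cons_gt0 : 0 < eps_cons.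
Hypothesis eps_gap_gt0 : 0 < eps_gap.
Variable ws : 'cV[R]_(n + n).
Hypothesis opts : Wopt A b c ws.
Hypothesis ws_gt0 : 0 < enorm ws.

Local Notation acc := (accepted A b c eps_cons eps_gap).
Let Bd := Num.sqrt (2 * kappa A) * enorm ws.

Let Bd_gt0 : 0 < Bd. Proof. by rewrite mulr_gt0 // sqrtr_gt0 mulr_gt0. Qed.

Lemma accepted_of_gap_ball z r e : pdhg_inv A z -> 0 < r -> 0 <= e ->
  r <= 2 * Bd -> snorm M z <= 2 * Bd ->
  (forall zh, orthant (usubmx zh) -> snorm M (zh - z) <= r ->
    saddle_gap A b c z zh <= r * e) ->
  Num.sqrt (kappa A) * e <= eps_cons -> 2 * Bd * e <= eps_gap -> acc z.
Proof.
move=> [z0 _] r0 e0 rB zB H ec eg.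
have [rp rd rg] := gap_ball_errors A_neq0 c_null b_im r0 e0 z0 H.
have se0 : 0 <= Num.sqrt (kappa A) * e by rewrite mulr_ge0 // ltW.
have [Ec _] := residual_errors A_neq0 c_null b_im z0 se0 rp rd.
split; first exact: le_trans Ec ec.
rewrite /Egap ge_max (ltW eps_gap_gt0) /= (le_trans rg) // (le_trans _ eg) //.
by rewrite ler_wpM2r // ge_max rB.
Qed.

(** If the average has not moved, the ball estimate holds for every radius [eta], with a bound on
    the normalized gap proportional to [eta]; a small [eta] meets both tolerances. *)
Lemma accepted_of_stationary z k : (0 < k)%N -> pdhg_inv A z ->
  snorm M (avg z k - z) = 0 -> snorm M (avg z k) <= 2 * Bd -> acc (avg z k).
Proof.
move=> k_gt0 z0 stat zB.
have kR : (1 : R) <= k%:R by rewrite ler1n.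
pose eta := Num.min (2 * Bd) (Num.min (eps_cons / (2 * Num.sqrt (kappa A)))
                                      (eps_gap / (4 * Bd))).
have B2 : 0 < 2 * Bd by exact: mulr_gt0.
have B4 : 0 < 4 * Bd by exact: mulr_gt0.
have S2 : 0 < 2 * Num.sqrt (kappa A) by exact: mulr_gt0.
have eta0 : 0 < eta by rewrite !lt_min B2 !divr_gt0.
have [h1 [h2 h3]] : eta <= 2 * Bd /\ (eta <= eps_cons / (2 * Num.sqrt (kappa A))
    /\ eta <= eps_gap / (4 * Bd)).
  by rewrite /eta !ge_min !lexx !orbT.
have ke : 2 * eta / k%:R <= 2 * eta.
  by rewrite ler_pdivrMr ?(lt_le_trans _ kR) //; nra.
apply: (@accepted_of_gap_ball _ eta (2 * eta / k%:R)) => //.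
- exact: pdhg_inv_avg.
- by rewrite divr_ge0 // mulr_ge0 // ltW.
- move=> zh zh0 zhr; apply: (avg_gap_ball tau_gt0 sigma_gt0 Mpsd) => //.
  by rewrite stat ltW.
- rewrite (ler_pdivlMr _ _ S2) in h2.
  apply: (@le_trans _ _ (Num.sqrt (kappa A) * (2 * eta))); last by lra.
  by rewrite ler_pM2l.
- rewrite (ler_pdivlMr _ _ B4) in h3.
  apply: (@le_trans _ _ (2 * Bd * (2 * eta))); last by lra.
  by rewrite (ler_pM2l B2).
Qed.

Lemma run_inv N z k : runs N z k -> forall j, (j <= N)%N -> pdhg_inv A (z j).
Proof.
move=> [z0 zr]; elim=> [|j IH] jN; first by rewrite z0; exact: pdhg_inv0.
by have [_ ->] := zr j jN; apply: pdhg_inv_avg => //; apply: IH; exact: ltnW.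
Qed.

(** One saddle point, chosen near the start, serves all restart points by Fejer monotonicity. *)
Lemma run_bounded N z k : runs N z k -> exists2 zs, saddle A b c zs &
  forall j, (j <= N)%N -> snorm M (z j - zs) <= Bd.
Proof.
move=> zr; have [zs zsP zsB] := saddle_near (pdhg_inv0 A) opts.
exists zs => //; elim=> [|j IH] jN.
  rewrite zr.1; apply: le_trans zsB _.
  by apply: ler_wpM2l; [exact: sqrtr_ge0|apply: wof0_near; case: opts => [[]]].
have [[kj0 _ _] ->] := zr.2 j jN.
apply: le_trans (avg_dist tau_gt0 sigma_gt0 Mpsd b_im kj0 _ zsP) (IH (ltnW jN)).
by apply: run_inv zr _ _; exact: ltnW.
Qed.

Lemma run_bounds N z k : runs N z k -> forall j, (j <= N)%N ->
  snorm M (z j) <= 2 * Bd /\ ((0 < j)%N -> snorm M (z j - z j.-1) <= 2 * Bd).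
Proof.
move=> zr; have [zs _ zsB] := run_bounded zr.
have B2 u v : snorm M (u - zs) <= Bd -> snorm M (v - zs) <= Bd ->
    snorm M (u - v) <= 2 * Bd.
  move=> uB vB; apply: le_trans (snormB_le _ zs _ Mpsd) _.
  by rewrite (snormC _ zs); lra.
move=> j jN; split.
  rewrite -[z j]subr0; apply: B2; first exact: zsB.
  by have := zsB 0%N isT; rewrite zr.1.
by move=> j0; apply: B2; apply: zsB => //; apply: leq_trans (leq_pred _) jN.
Qed.

Lemma run_move_gt0 N z k j : runs N z k -> (j < N)%N -> ~ acc (z j.+1) ->
  0 < snorm M (z j.+1 - z j).
Proof.
move=> zr jN nacc; rewrite lt0r snorm_ge0 andbT; apply/eqP => stat.
apply: nacc; have [[kj0 _ _] zE] := zr.2 j jN.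
have [zB _] := run_bounds zr jN.
rewrite zE in stat zB *; apply: accepted_of_stationary => //.
by apply: run_inv zr _ _; exact: ltnW.
Qed.

Lemma run_ndg N z k j : runs N z k -> (j < N)%N ->
  (rho (snorm M (z j.+1 - z j)) (z j.+1) <= (4 * Bd * beta ^+ j)%:E)%E.
Proof.
move=> zr; have [zs zsP zsB] := run_bounded zr.
elim: j => [|j IH] jN.
  have [[kj0 rs _] zE] := zr.2 0%N jN; rewrite /= in rs.
  rewrite zE rs expr0 mulr1.
  apply: le_trans (ndg_avg tau_gt0 sigma_gt0 Mpsd b_im _ _ zsP) _ => //.
    exact: run_inv zr _ _.
  by rewrite lee_fin divr1 ler_pM2l // zsB.
have [[kj0 rs _] zE] := zr.2 j.+1 jN; rewrite zE.
apply: le_trans rs _.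
have -> : (4 * Bd * beta ^+ j.+1)%:E = (beta%:E * (4 * Bd * beta ^+ j)%:E)%E.
  by rewrite -EFinM exprS mulrCA.
apply: lee_wpmul2l (IH (ltnW jN)).
by rewrite lee_fin invr_ge0 expR_ge0.
Qed.

(** The lower bound is the contrapositive of [accepted_of_gap_ball]: a small finite value of [rho]
    would mean acceptance. *)
Lemma run_ndg_fin N z k j : runs N z k -> (j < N)%N -> ~ acc (z j.+1) ->
  exists e : R, [/\ 0 <= e,
    rho (snorm M (z j.+1 - z j)) (z j.+1) = e%:E,
    e <= 4 * Bd * beta ^+ j &
    1 < Num.sqrt (kappa A) * e *
        Num.max (1 / eps_cons) (2%:R * Num.sqrt 2%:R * enorm ws / eps_gap)].
Proof.
move=> zr jN nacc; have zinv := run_inv zr jN.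
have r0 := run_move_gt0 zr jN nacc.
have := ndg_ge0 A b c tau0 sigma0 (ltW r0) zinv.1.
have := run_ndg zr jN.
set rh := rho _ _ => h1 h2.
have rhE : rh = (fine rh)%:E.
  rewrite fineK // fin_numE; apply/andP; split.
    by apply/eqP => rE; rewrite rE in h2.
  by apply/eqP => rE; rewrite rE in h1.
exists (fine rh); rewrite -lee_fin -rhE; split => //.
  by rewrite -lee_fin -rhE.
set e := fine rh in rhE *.
have e0 : 0 <= e by rewrite -lee_fin -rhE.
have [zB zrB] := run_bounds zr jN.
have not_small : ~ (Num.sqrt (kappa A) * e <= eps_cons /\ 2 * Bd * e <= eps_gap).
  move=> [ec eg]; apply: nacc.
  apply: (accepted_of_gap_ball zinv r0 e0 (zrB isT) zB _ ec eg).
  by move=> zh zh0 zhr; apply: (ndg_ge r0 _ zh0 zhr); rewrite -rhE.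
rewrite maxr_pMr; last by rewrite mulr_ge0 // ltW.
rewrite lt_max !mulrA mulr1 !ltr_pdivlMr // !mul1r.
apply/negP => /negP; rewrite negb_or -!leNgt => /andP[ec eg].
apply: not_small; split=> //; apply: le_trans eg.
by rewrite /Bd sqrtrM // le_eqVlt; apply/orP; left; apply/eqP; ring.
Qed.

(** * Length of one outer iteration and existence of runs *)

Section RestartLength.
Variables (wr : 'cV[R]_(n + n)) (r delta D : R).
Hypothesis r_gt0 : 0 < r.
Hypothesis Fwr : F wr.
Hypothesis wr_ge : forall i, r <= wr i 0.
Hypothesis wr_gap : gap wr <= delta.
Hypothesis delta_gt0 : 0 < delta.
Hypothesis delta_le : (delta%:E <= best_gap A b c)%E.
Hypothesis diam : forall u v, Wlevel A b c delta u -> Wlevel A b c delta v ->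
  enorm (u - v) <= D.

Let X := kappa A * (D / r).

(** By complementarity an optimal point has a zero coordinate, where [wr] is at least [r]. The bound
    D / r >= 1 absorbs lower-order terms below. *)
Lemma radius_le_diameter : r <= D.
Proof.
have n0 := ncols_gt0 A_neq0.
have [Fws /= gws] := opts.
have Ws : Wlevel A b c delta ws by split=> //=; rewrite gws ltW.
have [Vws [x0 s0]] := Fws.
have [i wsi] : exists i, ws i 0 = 0.
  pose i0 := Ordinal n0.
  have /eqP : dot (usubmx ws) (dsubmx ws) = 0 by rewrite -(Gap_Vpd c_null b_im Vws).
  rewrite psumr_eq0 => [/allP/(_ i0 (mem_index_enum _))|i _]; last by rewrite mulr_ge0.
  rewrite mulf_eq0 => /orP[/eqP|/eqP]; rewrite mxE => h.
    by exists (lshift n i0).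
  by exists (rshift n i0).
apply: le_trans (wr_ge i) _; apply: le_trans (diam (_ : Wlevel _ _ _ _ wr) Ws) => //.
apply: le_trans (coord_le_enorm (wr - ws) i); rewrite !mxE wsi subr0.
exact: ler_norm.
Qed.

Let X_ge1 : 1 <= X.
Proof.
have k1 := kappa_ge1 A_neq0.
have : 1 <= D / r by rewrite ler_pdivlMr // mul1r radius_le_diameter.
by rewrite /X; nra.
Qed.

Lemma radius_norm_le : r * enorm ws <= delta.
Proof.
have [Fws /= gws] := opts.
apply: le_trans (enorm_le_Gap c_null b_im r_gt0 Fws Fwr wr_ge) _.
by rewrite gws add0r.
Qed.

(* [D / delta <= D / (r |ws|)] absorbs the factor [|ws|] by which the gap
   exceeds the residuals, so all error terms carry the same ratio [D / r]. *)
Lemma saddle_dist_le N z k j e : runs N z k -> (j < N)%N -> ~ acc (z j.+1) ->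
  rho (snorm M (z j.+1 - z j)) (z j.+1) = e%:E -> 0 <= e ->
  exists2 zs, saddle A b c zs & 12 * snorm M (z j.+1 - zs) <= 99 * X * e.
Proof.
move=> zr jN nacc eE e0; have zinv := run_inv zr jN.
have r0 := run_move_gt0 zr jN nacc.
have [zB zrB] := run_bounds zr jN.
have ball zh : orthant (usubmx zh) -> snorm M (zh - z j.+1) <= snorm M (z j.+1 - z j) ->
    saddle_gap A b c (z j.+1) zh <= snorm M (z j.+1 - z j) * e.
  by move=> zh0 zhr; apply: (ndg_ge r0 _ zh0 zhr); rewrite eE.
have [rp rd rg] := gap_ball_errors A_neq0 c_null b_im r0 e0 zinv.1 ball.
set f := Num.sqrt (kappa A) * e in rp rd.
have f0 : 0 <= f by rewrite mulr_ge0 // ltW.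
have [_ [w' [Vw' ww' w'f gw']]] := residual_errors A_neq0 c_null b_im zinv.1 f0 rp rd.
have [wo opto wodist] := error_bound c_null b_im r_gt0 Fwr wr_ge delta_gt0
  delta_le diam opts Vw' f0 w'f wr_gap.
have [zs zsP zsd] := saddle_near zinv opto.
exists zs => //.
have D0 : 0 < D by exact: lt_le_trans radius_le_diameter.
have g2 : Num.max 0 (gap w') <= 2 * Bd * e.
  rewrite gw' ge_max mulr_ge0 ?(ltW (mulr_gt0 _ Bd_gt0)) //=.
  by rewrite (le_trans rg) // ler_wpM2r // ge_max zrB.
pose s2 : R := Num.sqrt 2%:R.
have [s20 s2le] := sqrt2_bounds R; rewrite -/s2 in s20 s2le.
have s2sq : s2 ^+ 2 = 2 by rewrite sqr_sqrtr.
have BdE : Bd = s2 * Num.sqrt (kappa A) * enorm ws by rewrite /Bd sqrtrM.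
have h1 : D / delta * Num.max 0 (gap w') <= 2 * s2 * (D / r) * f.
  apply: (@le_trans _ _ (D / delta * (2 * Bd * e))).
    by rewrite ler_pM2l ?divr_gt0.
  have -> : D / delta * (2 * Bd * e) =
      2 * s2 * (D / r) * f * (r * enorm ws / delta).
    by rewrite BdE /f; field; rewrite !gt_eqF.
  rewrite ler_piMr //.
    by rewrite !mulr_ge0 // ?(ltW s20) ?(ltW D0) // invr_ge0 ltW.
  by rewrite ler_pdivrMr // mul1r radius_norm_le.
have Dr : 1 <= D / r by rewrite ler_pdivlMr // mul1r radius_le_diameter.
(* Of the constant, 1 is the step to [w'], 2 is the pull towards the center and 2 sqrt 2 comes from
   the gap. *)
have h2 : enorm (wof A c (z j.+1) - wo) <= (3 + 2 * s2) * (D / r) * f.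
  apply: le_trans (enormB_le _ w' _) _.
  have : f <= D / r * f by rewrite ler_peMl.
  have : 2 * (f / r) * D = 2 * (D / r) * f by field; rewrite gt_eqF.
  by rewrite /wof; lra.
have h3 : snorm M (z j.+1 - zs) <= s2 * (3 + 2 * s2) * X * e.
  apply: le_trans zsd _.
  apply: (@le_trans _ _ (Num.sqrt (2 * kappa A) * ((3 + 2 * s2) * (D / r) * f))).
    by rewrite ler_wpM2l ?sqrtr_ge0.
  rewrite sqrtrM // -/s2 /f /X.
  have kE : kappa A = Num.sqrt (kappa A) ^+ 2 by rewrite sqr_sqrtr // ltW.
  rewrite [in leRHS]kE le_eqVlt; apply/orP; left; apply/eqP; ring.
have Xe : 0 <= X * e by rewrite mulr_ge0 // (le_trans _ X_ge1).
apply: (@le_trans _ _ (12 * (s2 * (3 + 2 * s2)) * (X * e))).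
  by move: h3; move: (snorm M _) (s2 * (3 + 2 * s2)) => u a; lra.
(* The 12 is 4 from [ndg_avg] times the bound 3 on e; the bracket is 4 + 3 sqrt 2 < 8.25. *)
have s12 : 12 * (s2 * (3 + 2 * s2)) <= 99 by move: s2sq; rewrite expr2; lra.
by have := ler_wpM2r Xe s12; rewrite (mulrA 99).
Qed.

Lemma restart_holds N z k j l : runs N z k -> (j <= N)%N -> (0 < j)%N -> ~ acc (z j) ->
  (0 < l)%N -> 99 * X <= l%:R -> restart z j l.
Proof.
move=> zr; case: j => // j jN _ nacc l_gt0 lX.
have [e [e0 eE _ _]] := run_ndg_fin zr jN nacc.
have [zs zsP zsd] := saddle_dist_le zr jN nacc eE e0.
have lR : (0 : R) < l%:R by rewrite ltr0n.
rewrite /restart_at -[Mnorm _ _ _ (z j.+1 - z j)]/(snorm M (z j.+1 - z j)) eE -EFinM.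
apply: le_trans (ndg_avg tau_gt0 sigma_gt0 Mpsd b_im l_gt0 (run_inv zr jN) zsP) _.
rewrite lee_fin ler_pdivrMr //.
have e1 := expR1_le3 R; have eg := expR_gt0 (1 : R).
have b3 : 1 / 3 <= beta by rewrite div1r lef_pV2 // posrE.
have el : 0 <= e * l%:R by rewrite mulr_ge0.
have h : 99 * X * e <= e * l%:R by rewrite mulrC ler_wpM2l.
have : 1 / 3 * (e * l%:R) <= beta * (e * l%:R) by rewrite ler_wpM2r.
rewrite mulrA; lra.
Qed.

(** Rounding up costs at most 1, which is at most [X]; hence 100 in place of 99. *)
Let K := (Num.truncn (99 * X)).+1.

Lemma K_bounds : 99 * X <= K%:R /\ K%:R <= 100 * X.
Proof.
split; first by rewrite ltW // truncnS_gt.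
have X0 : 0 <= 99 * X by have := X_ge1; lra.
have h : (Num.truncn (99 * X))%:R <= 99 * X by rewrite truncn_le.
by rewrite /K -natr1; have := X_ge1; lra.
Qed.

Lemma restart_length_exists N z k : runs N z k -> ~ acc (z N) ->
  exists l, length z N l.
Proof.
move=> zr nacc.
have [l rl] : exists l, (0 < l)%N && `[< restart z N l >].
  case: N zr nacc => [|N] zr nacc; first by exists 1%N; apply/asboolP.
  by exists K; apply/asboolP; apply: restart_holds zr _ _ nacc _ _; have [] := K_bounds.
have exl : exists l, (0 < l)%N && `[< restart z N l >] by exists l.
case: (ex_minnP exl) => l' /andP[l'0 /asboolP rl'] lmin; exists l'; split=> //.
move=> i /andP[i0 il'] ri.
by have := lmin i; rewrite i0 asboolT //= leqNgt il' => /(_ isT).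
Qed.

Lemma restart_length_le N z k j : runs N z k -> (j < N)%N -> (0 < j)%N ->
  ~ acc (z j) -> (k j)%:R <= 100 * X.
Proof.
move=> zr jN j0 nacc; have [Kl Ku] := K_bounds.
apply: le_trans Ku; rewrite ler_nat leqNgt; apply/negP => Kk.
have [[_ _ kmin] _] := zr.2 j jN.
apply: (kmin K); first by rewrite Kk andbT.
by apply: restart_holds zr (ltnW jN) j0 nacc _ _.
Qed.

Lemma total_length_le N z k : runs N.+1 z k -> (forall j, (j < N.+1)%N -> ~ acc (z j)) ->
  (\sum_(j < N.+1) k j)%N%:R <= 1 + N%:R * (100 * X) :> R.
Proof.
move=> zr nacc; rewrite big_ord_recl natrD.
have [[_ /= -> _] _] := zr.2 0%N isT.
rewrite lerD2l natr_sum mulr_natl.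
rewrite -[X in _ *+ X](card_ord N) -sumr_const; apply: ler_sum => i _.
have iN := ltn_ord (lift ord0 i).
by apply: restart_length_le zr iN _ (nacc _ iN); rewrite lift0.
Qed.

(** A run is a relation, so it has to be built. A run without acceptance extends by one outer
    iteration, since the restart condition at [j] only reads restart points up to [j]. *)
Lemma accepted_run_or_longer N :
  (exists N' z k, [/\ runs N' z k, acc (z N') & forall j, (j < N')%N -> ~ acc (z j)]) \/
  (exists z k, runs N z k /\ forall j, (j <= N)%N -> ~ acc (z j)).
Proof.
elim: N => [|N [|[z [k [zr nacc]]]]]; [|by left|].
  have [a0|na0] := pselect (acc 0).
    by left; exists 0%N, (fun=> 0), (fun=> 0%N).
  right; exists (fun=> 0), (fun=> 0%N); split=> // j.
have [l zl] := restart_length_exists zr (nacc N (leqnn _)).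
pose z' i := if (i <= N)%N then z i else avg (z N) l.
pose k' i := if (i < N)%N then k i else l.
have z'E i : (i <= N)%N -> z' i = z i by rewrite /z' => ->.
have rsE j i : (j <= N)%N -> restart z' j i = restart z j i.
  case: j => //= j jN; rewrite !z'E //; exact: ltnW.
have lenE j i : (j <= N)%N -> length z j i -> length z' j i.
  move=> jN [i0 ri rmin]; split=> //; first by rewrite rsE.
  by move=> a /rmin; rewrite rsE.
have zr' : runs N.+1 z' k'.
  split=> [|j]; first by rewrite z'E // zr.1.
  rewrite ltnS leq_eqVlt /k' => /orP[/eqP ->|jN].
    by rewrite ltnn; split; [exact: lenE|rewrite {1}/z' ltnn z'E].
  have [h1 h2] := zr.2 j jN; rewrite jN (z'E j.+1) // (z'E j (ltnW jN)).
  by split=> //; apply: lenE => //; exact: ltnW.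
have nacc' j : (j <= N)%N -> ~ acc (z' j) by move=> jN; rewrite z'E //; exact: nacc.
have [aN|naN] := pselect (acc (z' N.+1)).
  by left; exists N.+1, z', k'; split.
right; exists z', k'; split=> // j; rewrite leq_eqVlt => /orP[/eqP -> //|].
by rewrite ltnS; exact: nacc'.
Qed.

End RestartLength.

(** The decay of [rho] by [beta ^+ j] meets the lower bound imposed by non-acceptance. *)
Lemma nonaccepted_run_bound N z k j : runs N z k -> (j < N)%N -> ~ acc (z j.+1) ->
  expR 1 ^+ j < 4 * Num.sqrt 2%:R * kappa A * enorm ws *
    Num.max (1 / eps_cons) (2%:R * Num.sqrt 2%:R * enorm ws / eps_gap).
Proof.
move=> zr jN nacc; have [e [e0 _ ele]] := run_ndg_fin zr jN nacc.
set mx := Num.max _ _ => h.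
have mx0 : 0 <= mx by rewrite le_max divr_ge0 // ltW.
have E0 := expR_gt0 (1 : R).
have Ej : 0 < expR (1 : R) ^+ j by rewrite exprn_gt0.
have : 1 < Num.sqrt (kappa A) * (4 * Bd * beta ^+ j) * mx.
  apply: lt_le_trans h _; rewrite ler_wpM2r // ler_pM2l //.
rewrite exprVn -(ltr_pM2r Ej) mul1r => h'; apply: lt_le_trans h' _.
rewrite le_eqVlt; apply/orP; left; apply/eqP.
have kE : kappa A = Num.sqrt (kappa A) ^+ 2 by rewrite sqr_sqrtr // ltW.
rewrite /Bd (sqrtrM _ (ler0n _ 2)) [in RHS]kE.
move: (Num.sqrt (kappa A)) (expR 1 ^+ j) Ej => s Ej' Ej0.
by field; rewrite gt_eqF.
Qed.

End Convergence.
End Restarts.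

(** * Level sets and the iteration bound *)

Section LevelSets.
Variables (R : realType) (m n : nat) (A : 'M[R]_(m, n)).
Variables (b : 'cV[R]_m) (c : 'cV[R]_n).

Local Notation F := (feasible A b c).
Local Notation gap := (Gap A b c).

Lemma interior_orthant_ge (x : 'cV[R]_n) : (@orthant R n)° x ->
  exists2 r, 0 < r & forall i, r <= x i 0.
Proof.
move=> /nbhs_ballP[e /= e0 xe]; exists (e / 2) => [|i]; first by rewrite divr_gt0.
have : orthant (x - const_mx (e / 2)).
  apply: xe; split=> // k j; rewrite !mxE -ball_normE /= opprB addrC subrK.
  by rewrite ger0_norm ?divr_ge0 ?(ltW e0) // ltr_pdivrMr //; lra.
by move=> /(_ i); rewrite !mxE subr_ge0.
Qed.

Lemma strictly_feasible :
  (exists x : 'cV[R]_n, Vp A b x /\ (@orthant R n)° x) ->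
  (exists s : 'cV[R]_n, Vd A c s /\ (@orthant R n)° s) ->
  exists w r, [/\ 0 < r, F w & forall i, r <= w i 0].
Proof.
move=> [x [Vx /interior_orthant_ge[r1 r10 xr]]] [s [Vs /interior_orthant_ge[r2 r20 sr]]].
exists (col_mx x s), (Num.min r1 r2).
have wr i : Num.min r1 r2 <= col_mx x s i 0.
  by case: (split_ordP i) => j ->; rewrite ?col_mxEu ?col_mxEd ge_min ?xr ?sr ?orbT.
split=> //; first by rewrite lt_min r10.
split; first by split; rewrite ?col_mxKu ?col_mxKd.
apply/Kpd_orthant => i; apply: le_trans (wr i).
by rewrite le_min !ltW.
Qed.

Hypothesis A_neq0 : A != 0.
Hypothesis c_null : A *m c = 0.
Variables (wr : 'cV[R]_(n + n)) (r : R).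
Hypothesis r_gt0 : 0 < r.
Hypothesis Fwr : F wr.
Hypothesis wr_ge : forall i, r <= wr i 0.

Let b_im : exists x : 'cV[R]_n, A *m x = b. Proof. exact: feasible_im Fwr. Qed.

(** Mixing a little of [wr] into an optimal point keeps all coordinates positive and the gap below
    any [delta > 0]. *)
Lemma Wlevel_center ws delta : Wopt A b c ws -> 0 < delta ->
  exists w r', [/\ 0 < r', Wlevel A b c delta w & forall i, r' <= w i 0].
Proof.
move=> [Fws /= gws] d0; have gwr := Gap_ge0 c_null b_im Fwr.
have [_ /Kpd_orthant ws0] := Fws.
pose t := delta / (delta + gap wr).
have dg : 0 < delta + gap wr by lra.
have t0 : 0 < t by rewrite divr_gt0.
have t1 : t <= 1 by rewrite ler_pdivrMr // mul1r; lra.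
exists (t *: wr + (1 - t) *: ws), (t * r); split; first exact: mulr_gt0.
  split; first by apply: feasible_comb => //; rewrite (ltW t0).
  rewrite /= Gap_comb gws mulr0 addr0 /t mulrAC ler_pdivrMr //.
  by rewrite ler_pM2l //; lra.
move=> i; rewrite !mxE.
have : t * r <= t * wr i 0 by rewrite ler_pM2l.
have : 0 <= (1 - t) * ws i 0 by rewrite mulr_ge0 // subr_ge0.
lra.
Qed.

Lemma le_diameter delta u v : Wlevel A b c delta u -> Wlevel A b c delta v ->
  enorm (u - v) <= diameter A b c delta.
Proof.
move=> Wu Wv; apply: ub_le_sup; last by exists u, v.
exists (2 * (delta + gap wr) / r) => _ [u' [v' [[Fu /= gu] [Fv /= gv] ->]]].
rewrite ler_pdivlMr // mulrC.
have hu := enorm_le_Gap c_null b_im r_gt0 Fu Fwr wr_ge.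
have hv := enorm_le_Gap c_null b_im r_gt0 Fv Fwr wr_ge.
have : r * enorm (u' - v') <= r * (enorm u' + enorm v').
  by rewrite ler_pM2l // -(enormN v') enormD.
lra.
Qed.

(* The conic radius is only approximated from below: no maximizer is needed. *)
Lemma ratio_bound ws delta (T C : R) : Wopt A b c ws -> 0 < delta ->
  0 < T -> 0 <= C ->
  (forall w r', 0 < r' -> Wlevel A b c delta w -> (forall i, r' <= w i 0) ->
     T <= C * (diameter A b c delta / r')) ->
  T <= C * (diameter A b c delta / conic_radius A b c delta).
Proof.
move=> opts d0 T0 C0 H; set D := diameter _ _ _ _ in H *.
have [w [r' [r'0 Ww wr']]] := Wlevel_center opts d0.
have D0 : 0 <= D by apply: le_trans (le_diameter Ww Ww); exact: enorm_ge0.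
pose S := [set r | 0 <= r /\ exists w, Wlevel A b c delta w /\ eball w r `<=` @Kpd R n].
have Sr' : S r'.
  by split; [exact: ltW|exists w; split=> //; apply/eball_coord => //; exact: ltW].
have ubS : ubound S (C * D / T).
  move=> a [a0 [v [Wv /(eball_coord _ a0) va]]].
  have [->|an0] := eqVneq a 0; first by rewrite divr_ge0 ?mulr_ge0 // ltW.
  have a_gt0 : 0 < a by rewrite lt0r an0.
  rewrite ler_pdivlMr // mulrC -ler_pdivlMr // -mulrA.
  exact: H a_gt0 Wv va.
have supS : conic_radius A b c delta <= C * D / T by apply: ge_sup ubS; exists r'.
have sup0 : 0 < conic_radius A b c delta.
  by apply: lt_le_trans r'0 _; apply: ub_le_sup => //; exists (C * D / T).
by rewrite mulrA ler_pdivlMr // mulrC -ler_pdivlMr.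
Qed.

(** For optimal [w], [Gap_add] and Cauchy-Schwarz give gap wr <= |w| |wr|, and gap wr > 0 because
    [wr] has positive coordinates. *)
Lemma dist0_Wopt_gt0 : 0 < dist 0 (Wopt A b c).
Proof.
have [ws opts] := Wopt_exists A_neq0 c_null r_gt0 Fwr wr_ge.
have i0 := Ordinal (ncols_gt0 A_neq0).
have wr0 : 0 < enorm wr.
  apply: lt_le_trans (coord_le_enorm wr (lshift n i0)).
  by rewrite normr_gt0 gt_eqF // (lt_le_trans r_gt0).
have gwr : 0 < gap wr.
  have [Vwr _] := Fwr; rewrite (Gap_Vpd c_null b_im Vwr) /dot (bigD1 i0) //=.
  rewrite ltr_wpDr ?sumr_ge0 // => [i _|]; rewrite !mxE.
    by rewrite mulr_ge0 // (le_trans (ltW r_gt0)).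
  by rewrite mulr_gt0 // (lt_le_trans r_gt0).
apply: (@lt_le_trans _ _ (gap wr / enorm wr)); first exact: divr_gt0.
apply: lb_le_inf; first by exists (enorm (0 - ws)), ws.
move=> _ [w [Fw /= gw] <-]; rewrite sub0r enormN ler_pdivrMr //.
have [Vw _] := Fw; have [Vwr _] := Fwr.
have := Gap_add c_null b_im Vw Vwr; rewrite gw add0r => ->.
apply: le_trans (enorm_CauchySchwarz _ _) _; rewrite ler_pM2l.
  rewrite le_eqVlt; apply/orP; left; apply/eqP.
  by rewrite -{3}[wr]vsubmxK /enorm !dot_col_mx addrC.
rewrite enorm_gt0; apply/eqP => w0.
by have := Gap_add c_null b_im Vw Vwr; rewrite gw w0 dot0l; lra.
Qed.

End LevelSets.

Theorem theorem4p1 (R : realType) (m n : nat) (A : 'M[R]_(m, n))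
    (b : 'cV[R]_m) (c : 'cV[R]_n)
    (A_neq0 : A != 0)
    (c_null : A *m c = 0)
    (primal_slater : exists x : 'cV[R]_n, Vp A b x /\ (@orthant R n)° x)
    (dual_slater : exists s : 'cV[R]_n, Vd A c s /\ (@orthant R n)° s)
    (eps_cons eps_gap : R) (eps_cons_gt0 : 0 < eps_cons)
    (eps_gap_gt0 : 0 < eps_gap) :
  exists T : nat,
    total_iterations A b c
      (kappa A)^-1 (lambda_max A * lambda_min A)^-1 (expR 1)^-1
      0 eps_cons eps_gap T
    /\
    (* [Num.max 0] matters only if T = 0: for large tolerances the
       logarithms may then sum to a negative number *)
    T%:R <= Num.max 0
      (133%:R * kappa A * best_ratio A b c *
       (ln (17%:R * kappa A * dist 0 (Wopt A b c)) +
        ln (Num.max (1 / eps_cons)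
              (2%:R * Num.sqrt 2%:R * dist 0 (Wopt A b c) / eps_gap)))).
Proof.
have [wr0 [r0 [r0_gt0 Fwr0 wr0_ge]]] := strictly_feasible primal_slater dual_slater.
have b_im := feasible_im Fwr0.
have k1 := kappa_ge1 A_neq0; have k0 := kappa_gt0 A_neq0.
set d := dist 0 (Wopt A b c).
have d0 : 0 < d by exact: (dist0_Wopt_gt0 A_neq0 c_null r0_gt0 Fwr0 wr0_ge).
have [s20 s2le] := sqrt2_bounds R.
have d_le w : Wopt A b c w -> d <= enorm w.
  by move=> ow; rewrite -enormN -sub0r; exact: dist_le.
(* A near-minimizer suffices; the factor 2001/2000 is paid for by the slack in 17. *)
have [ws opts ws_le] : exists2 ws, Wopt A b c ws & enorm ws <= 2001 / 2000 * d.
  have [w0 ow0] := Wopt_exists A_neq0 c_null r0_gt0 Fwr0 wr0_ge.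
  have [||_ [w ow <-] wlt] := @inf_lt R [set enorm (0 - v) | v in Wopt A b c]
      (2001 / 2000 * d).
  - by exists (enorm (0 - w0)), w0.
  - by rewrite -/(dist 0 (Wopt A b c)) -/d; lra.
  - by exists w => //; rewrite -enormN -sub0r ltW.
have ws0 : 0 < enorm ws by exact: lt_le_trans d0 (d_le _ opts).
pose mx (x : R) := Num.max (1 / eps_cons) (2%:R * Num.sqrt 2%:R * x / eps_gap).
have mx0 x : 0 < mx x by rewrite lt_max divr_gt0.
have mx_ws : mx (enorm ws) <= 2001 / 2000 * mx d.
  have md := mx0 d; rewrite ge_max; apply/andP; split.
    have : 1 / eps_cons <= mx d by rewrite le_max lexx.
    lra.
  apply: (@le_trans _ _ (2001 / 2000 * (2 * Num.sqrt 2%:R * d / eps_gap))); last first.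
    by rewrite ler_pM2l; [rewrite le_max lexx orbT|lra].
  rewrite !mulrA ler_pM2r ?invr_gt0 //.
  have : Num.sqrt 2%:R * enorm ws <= Num.sqrt 2%:R * (2001 / 2000 * d).
    by rewrite ler_pM2l.
  lra.
pose Y := kappa A * d * mx d.
have Y0 : 0 < Y by exact: mulr_gt0 (mulr_gt0 k0 d0) (mx0 d).
rewrite -/(mx d) -lnM ?posrE ?(mulr_gt0 (mulr_gt0 _ k0) d0) //.
have -> : 17%:R * kappa A * d * mx d = 17%:R * Y by rewrite /Y !mulrA.
have [delta0 delta0_gt0 delta0_le] := best_gap_gt0 c_null b_im.
have center := Wlevel_center c_null r0_gt0 Fwr0 wr0_ge opts.
have diam := le_diameter c_null r0_gt0 Fwr0 wr0_ge.
have e3 := expR1_le3 R; have e0 := expR_gt0 (1 : R); have e2 := expR_ge1Dx (1 : R).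
have [N [z [k [zr aN nacc]]]] : exists N z k,
    [/\ rPDHG_run A b c (kappa A)^-1 (lambda_max A * lambda_min A)^-1 (expR 1)^-1 0 N z k,
      accepted A b c eps_cons eps_gap (z N)
    & forall j, (j < N)%N -> ~ accepted A b c eps_cons eps_gap (z j)].
  have [w [r [r_gt0 [Fw gw] wr]]] := center _ delta0_gt0.
  pose B := 4 * Num.sqrt 2%:R * kappa A * enorm ws * mx (enorm ws).
  pose N := (Num.truncn B).+1.
  have [//|[z [k [zr nacc]]]] := accepted_run_or_longer A_neq0 c_null b_im eps_cons_gt0
    eps_gap_gt0 opts ws0 r_gt0 Fw wr gw delta0_gt0 delta0_le (@diam delta0) N.+1.
  have := nonaccepted_run_bound A_neq0 c_null b_im eps_cons_gt0 eps_gap_gt0 opts ws0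
    zr (ltnSn N) (nacc N.+1 (leqnn _)).
  rewrite -/(mx _) -/B -expRM_natl mulr1 => h.
  have := expR_ge1Dx (N%:R : R); have := truncnS_gt B; rewrite -/N; lra.
exists (\sum_(j < N) k j)%N; split; first by exists N, z, k.
(* If the starting point is accepted, T = 0 and [Num.max 0] settles the bound. *)
case: N zr aN nacc => [|N] zr aN nacc; first by rewrite big_ord0 le_max lexx.
(* The start has gap 0, so its rejection means that its infeasibility exceeds [eps_cons]; as that is
   at most the norm of every optimal point, [eps_cons <= d]. *)
have Y1 : 1 <= Y.
  have de : eps_cons <= d.
    apply: lb_le_inf; first by exists (enorm (0 - ws)), ws.
    move=> _ [w [Fw _] <-]; rewrite sub0r enormN leNgt; apply/negP => we.
    have := nacc 0%N isT; rewrite zr.1; apply; split.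
      by apply: le_trans (Econs0_le c_null Fw) (ltW we).
    by rewrite /Egap (Gap_wof0 c_null b_im) ge_max (ltW eps_gap_gt0).
  have : 1 <= d * mx d.
    apply: (@le_trans _ _ (d * (1 / eps_cons))).
      by rewrite mulrA mulr1 ler_pdivlMr // mul1r.
    by rewrite ler_pM2l // le_max lexx.
  by rewrite /Y -mulrA; nra.
have Lg1 : 1 <= ln (17%:R * Y).
  rewrite -[leLHS]expRK ler_ln ?posrE //; lra.
have lnN : N%:R <= ln (17%:R * Y).
  case: N zr {aN} nacc => [|N] zr nacc; first exact: le_trans Lg1.
  have := nonaccepted_run_bound A_neq0 c_null b_im eps_cons_gt0 eps_gap_gt0 opts ws0
    zr (ltnW (ltnSn N.+1)) (nacc N.+1 (ltnSn _)).
  rewrite -/(mx _) => h.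
  rewrite -[leLHS]expRK -[N.+1%:R]mulr1 expRM_natl ler_ln ?posrE ?exprn_gt0 ?(mulr_gt0 _ Y0) //.
  (* Origin of 17: 4 sqrt 2 (2001/2000)^2 <= 17/3, with the factor 2001/2000 used once for |ws| and
     once for [mx]. The last outer iteration contributes one more factor e <= 3. *)
  have B0 : 4 * Num.sqrt 2%:R * kappa A * enorm ws * mx (enorm ws) <= 17 / 3 * Y.
    have : kappa A * enorm ws * mx (enorm ws) <= (2001 / 2000) ^+ 2 * Y.
      have -> : (2001 / 2000) ^+ 2 * Y = kappa A * (2001 / 2000 * d) * (2001 / 2000 * mx d).
        by rewrite /Y; ring.
      apply: ler_pM => //; [|exact: ltW|by rewrite ler_pM2l].
      by rewrite mulr_ge0 // ltW.
    have : 0 <= kappa A * enorm ws * mx (enorm ws).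
      exact: mulr_ge0 (mulr_ge0 (ltW k0) (ltW ws0)) (ltW (mx0 _)).
    have -> : 4 * Num.sqrt 2%:R * kappa A * enorm ws * mx (enorm ws) =
      4 * (Num.sqrt 2%:R * (kappa A * enorm ws * mx (enorm ws))) by ring.
    move: (kappa A * enorm ws * mx (enorm ws)) => u u0 h1.
    have : Num.sqrt 2%:R * u <= 283 / 200 * ((2001 / 2000) ^+ 2 * Y).
      by apply: ler_pM => //; exact: ltW.
    by rewrite expr2; lra.
  rewrite exprS.
  have : expR 1 * expR 1 ^+ N <= 3 * (17 / 3 * Y).
    by apply: ler_pM => //; exact: ltW (lt_le_trans h B0).
  lra.
rewrite le_max; apply/orP; right.
set Lg := ln _ in Lg1 lnN *.
set T := (\sum_(j < N.+1) k j)%N.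
have T1 : (1 : R) <= T%:R.
  have [[k00 _ _] _] := zr.2 0%N isT.
  by rewrite ler1n /T big_ord_recl ltn_addr.
have T0 : (0 : R) < T%:R by lra.
have C0 : 0 < 133%:R * kappa A * Lg.
  by rewrite (mulr_gt0 (mulr_gt0 _ k0)) // (lt_le_trans ltr01).
have -> : 133%:R * kappa A * best_ratio A b c * Lg =
    133%:R * kappa A * Lg * best_ratio A b c by rewrite mulrAC.
rewrite mulrC -ler_pdivrMr //.
apply: lb_le_inf; first by eexists; exists delta0; first by split.
move=> _ [delta [delta_gt0 delta_le] <-]; rewrite ler_pdivrMr // mulrC.
apply: (ratio_bound c_null r0_gt0 Fwr0 wr0_ge opts) => //; first exact: ltW.
move=> w r r_gt0 [Fw gw] wr.
have X1 : 1 <= kappa A * (diameter A b c delta / r).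
  have : 1 <= diameter A b c delta / r.
    rewrite ler_pdivlMr // mul1r.
    exact: (radius_le_diameter A_neq0 c_null b_im opts Fw wr gw delta_gt0 (@diam delta)).
  nra.
apply: le_trans (total_length_le A_neq0 c_null b_im eps_cons_gt0 eps_gap_gt0 opts ws0
  r_gt0 Fw wr gw delta_gt0 delta_le (@diam delta) zr nacc) _.
have -> : 133%:R * kappa A * Lg * (diameter A b c delta / r) =
  133%:R * (Lg * (kappa A * (diameter A b c delta / r))) by ring.
set X := kappa A * _ in X1 *.
(* Both logarithm and ratio are at least 1, so the single step of the first outer iteration is
   absorbed: 1 + 100 N X <= 101 Lg X. *)
have h1 : 1 <= Lg * X by rewrite -[leLHS]mulr1; apply: ler_pM.
have h2 : N%:R * X <= Lg * X by rewrite ler_wpM2r //; lra.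
lra.
Qed.
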